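(* Let $(g,u,\lambda)$ be a normal extremal (as defined in the context) of the optimal control problem $$\min_{u(\cdot)}\int_0^T\big[C(g(t),u(t)-e_0)+V(g(t))\big]\,dt\quad\text{subject to}\quad \dot g(t)=T_eL_{g(t)}(u(t)),\quad g(0)=g_0,\quad g(T)=g_T,$$ under the assumptions (i)--(vi) listed in the context, and put $\alpha(t)=\rho^*_{g(t)}(\alpha_0)\in X^*$. Then $(u,\lambda,\alpha)$ satisfies the Euler--Poincaré equations $$\frac{d}{dt}\left(\frac{\partial C}{\partial u}+\lambda\right)=\mathrm{ad}^*_u\left(\frac{\partial C}{\partial u}+\lambda\right)+\mathbf{J}_X\left(\frac{\partial V_{\mathrm{ext}}}{\partial\alpha},\alpha\right),$$ $$\dot\alpha=\rho'^{*}_u(\alpha),\qquad \alpha(0)=\rho^*_{g_0}(\alpha_0).$$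
   Context: Lie group and controls. $G$ is an $n$-dimensional real Lie group with identity $e$ and Lie algebra $\mathfrak g$ with basis $e_1,\dots,e_n$; $L_g$ is left translation; $1\le m\le n$, $\mathfrak k=\mathrm{span}\{e_1,\dots,e_m\}$, $\mathfrak p=\mathrm{span}\{e_{m+1},\dots,e_n\}$, $e_0\in\mathfrak p$ is fixed, and $E=G\times\mathfrak k$. Controls are curves $u(t)=e_0+\sum_{i=1}^m u^i(t)e_i$ with $u^i(t)\in\mathbb R$, and $g\in C^1([0,T],G)$. Using $\mathfrak g=\mathfrak k\oplus\mathfrak p$, identify $\mathfrak k^*$ with the annihilator of $\mathfrak p$ in $\mathfrak g^*$ and $\mathfrak p^*$ with the annihilator of $\mathfrak k$. For $v\in\mathfrak g$ with a $\mathfrak p$-component, $C(g,v)$ means $C$ evaluated at the $\mathfrak k$-component of $v$ (along $\mathfrak p$). Assumptions. (i) $C:E\to\mathbb R$ is sufficiently regular (say smooth) and $G$-invariant: $C(gh,v)=C(h,v)$ for all $g,h\in G$, $v\in\mathfrak k$. (ii) $V:G\to\mathbb R$ is sufficiently regular (say smooth) and is not $G$-invariant. (iii) There are a finite-dimensional real vector space $X$, an element $\alpha_0\in X^*$ and a sufficiently regular (say smooth) function $V_{\mathrm{ext}}:G\times X^*\to\mathbb R$ with $V_{\mathrm{ext}}(\cdot,\alpha_0)=V$. (iv) $\rho:G\to \mathrm{GL}(X)$ is a (smooth) representation; for $g\in G$, $\rho_g^*\in\mathrm{GL}(X^* )$ is the adjoint of $\rho_g$, $\langle\rho_g^*(\alpha),x\rangle=\langle\alpha,\rho_g(x)\rangle$,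 so that $(g,(h,\alpha))\mapsto(gh,\rho^*_{g^{-1}}(\alpha))$ is a left action of $G$ on $G\times X^*$. (v) $V_{\mathrm{ext}}(gh,\rho^*_{g^{-1}}(\alpha))=V_{\mathrm{ext}}(h,\alpha)$ for all $g,h\in G$, $\alpha\in X^*$. (vi) $V$ is invariant under left translation by the isotropy group $G_{\alpha_0}=\{g\in G:\rho_g^*(\alpha_0)=\alpha_0\}$. Notation. $C(v):=C(e,v)$ for $v\in\mathfrak k$, and $\frac{\partial C}{\partial u}\in\mathfrak k^*\subset\mathfrak g^*$ is the differential of $C$ at $u-e_0$. $V_{\mathrm{ext}}(\alpha):=V_{\mathrm{ext}}(e,\alpha)$, and $\frac{\partial V_{\mathrm{ext}}}{\partial\alpha}\in X^{**}\cong X$ is its differential at $\alpha$. $\mathrm{ad}_\xi\eta=[\xi,\eta]$ and $\langle\mathrm{ad}^*_\xi\mu,\eta\rangle=\langle\mu,\mathrm{ad}_\xi\eta\rangle$. $\rho':\mathfrak g\to\mathfrak{gl}(X)$ is the Lie algebra representation induced by $\rho$, and $\rho'^{*}_\xi\in\mathfrak{gl}(X^* )$ is the adjoint of $\rho'_\xi$. The momentum map $\mathbf J_X:X\times X^*\to\mathfrak g^*$ is $\langle\mathbf J_X(x,\alpha),\xi\rangle=\langle\alpha,\rho'_\xi(x)\rangle$ for $\xi\in\mathfrak g$. Normal extremal. Let $L_{a,\alpha_0}(g,u,\lambda)=C(g,u-e_0)+V_{\mathrm{ext}}(g,\alpha_0)+\langle\lambda,u-e_0\rangle$. A normal extremal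 is a triple $(g,u,\lambda)$ with $g\in C^1([0,T],G)$, $g(0)=g_0$, $g(T)=g_T$, $u(t)=T_{g(t)}L_{g(t)^{-1}}(\dot g(t))\in e_0+\mathfrak k$, and $\lambda\in C^1([0,T],\mathfrak p^* )$ a Lagrange multiplier, satisfying the variational principle $\delta\int_0^T L_{a,\alpha_0}(g(t),u(t),\lambda(t))\,dt=0$ for all variations of $g$ vanishing at the endpoints, together with the induced variations of $u=T_gL_{g^{-1}}(\dot g)$ (which are $\mathfrak g$-valued, the constraint $u-e_0\in\mathfrak k$ being imposed by $\lambda$). *)

(* Defs.v *)
From HB Require Import structures.
From mathcomp Require Import all_boot all_order all_algebra.
From mathcomp Require Import all_classical all_reals all_analysis.

Set Implicit Arguments.
Unset Strict Implicit.
Unset Printing Implicit Defensive.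

Import Order.TTheory GRing.Theory Num.Theory.
Import numFieldNormedType.Exports.

Local Open Scope classical_set_scope.
Local Open Scope ring_scope.

Section Calculus.
Variable R : realType.

(* [Ck_on] and [smooth_on] are meant for open [A] in a finite-dimensional [V];
   there, differentiability together with continuity of every directional
   derivative is C^1. *)
Fixpoint Ck_on (V W : normedModType R) (k : nat) (A : set V) (f : V -> W) :
    Prop :=
  match k with
  | 0%N => forall x, A x -> {for x, continuous f}
  | k'.+1 => (forall x, A x -> differentiable f x) /\
             forall v, Ck_on k' A (fun x => 'D_v f x)
  end.

Definition smooth_on (V W : normedModType R) (A : set V) (f : V -> W) : Prop :=
  forall k, Ck_on k A f.

(* Derivative relative to [A], hence one-sided at the end points when [A] is a
   closed interval. *)
Definition diff_quot (W : normedModType R) (f : R -> W) (t s : R) : W :=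
  (s - t)^-1 *: (f s - f t).

Definition is_derive_in (W : normedModType R) (A : set R) (f : R -> W) (t : R)
    (l : W) : Prop :=
  diff_quot f t @ within A t^' --> l.

Definition derivable_in (W : normedModType R) (A : set R) (f : R -> W)
    (t : R) : Prop :=
  cvg (diff_quot f t @ within A t^').

Definition D_in (W : normedModType R) (A : set R) (f : R -> W) (t : R) : W :=
  lim (diff_quot f t @ within A t^').

Definition C1_in (W : normedModType R) (A : set R) (f : R -> W) : Prop :=
  (forall t, A t -> derivable_in A f t) /\ {within A, continuous (D_in A f)}.

Definition continuous_in_at (X Y : topologicalType) (A : set X) (f : X -> Y)
    (x : X) : Prop :=
  f @ within A (nbhs x) --> f x.

End Calculus.

Section Dual.
Variable R : realType.

Definition dual (X : vectType R) := 'Hom(X, R^o).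

(* Finite-dimensional duals carry no topology in the library: differentiability
   of dual-valued curves is expressed by pairing with every vector. *)
Definition dual_is_derive_in (X : vectType R) (A : set R) (f : R -> dual X)
    (t : R) (l : dual X) : Prop :=
  forall x : X, is_derive_in A (fun s => f s x : R) t (l x).

Definition dual_C1_in (X : vectType R) (A : set R) (f : R -> dual X) : Prop :=
  forall x : X, C1_in A (fun s => f s x : R).

(* The differential of [F] at [a], evaluated at [v]. *)
Definition dirD (W : vectType R) (F : W -> R) (a v : W) : R :=
  derive1 (fun s : R => F (a + s *: v) : R^o) 0.

(* The differential of a function on [X^*], seen in [X] through [X^** = X]: the
   vector [x] such that [b x = dirD F a b] for all [b : dual X]. *)
Definition grad_dual (X : vectType R) (F : dual X -> R) (a : dual X) : X :=
  let b := vbasis {:X} in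
  \sum_(i < \dim {:X})
    dirD F a (linfun (fun x => coord b i x : R^o)) *: b`_i.

Definition adjoint (X : vectType R) (A : 'End(X)) (a : dual X) : dual X :=
  (a \o A)%VF.

End Dual.

Section Chart.
Variables (R : realType) (n : nat) (M : topologicalType).

Record chart := Chart {
  cdom : set M;
  ccod : set 'rV[R]_n;
  cmap :> M -> 'rV[R]_n;
  cinv : 'rV[R]_n -> M;
  cdom_open : open cdom;
  ccod_open : open ccod;
  cmap_cod : forall x, cdom x -> ccod (cmap x);
  cinv_dom : forall y, ccod y -> cdom (cinv y);
  cmapK : forall x, cdom x -> cinv (cmap x) = x;
  cinvK : forall y, ccod y -> cmap (cinv y) = y;
  cmap_continuous : forall x, cdom x -> {for x, continuous cmap};
  cinv_continuous : forall y, ccod y -> {for y, continuous cinv}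
}.

End Chart.

(* A smooth atlas is given as a family of charts indexed by the points of [G],
   the chart [chart_at p] containing [p]; every atlas can be so indexed. The
   tangent space at [p] is then ['rV[R]_n], read in the chart [chart_at p]. *)
HB.mixin Record isLieGroup (R : realType) (n : nat) G
    of Group G & Topological G := {
  lie_hausdorff : hausdorff_space G;
  lie_second_countable : @second_countable G;
  chart_at : G -> chart R n G;
  mem_chart_at : forall p, cdom (chart_at p) p;
  chart_compat : forall p q,
    smooth_on [set y | ccod (chart_at p) y /\
                       cdom (chart_at q) (cinv (chart_at p) y)]
      (chart_at q \o cinv (chart_at p));
  lie_mul_continuous : continuous (fun z : G * G => (z.1 * z.2)%g);
  lie_inv_continuous : continuous (fun x : G => (x^-1)%g);
  lie_mul_smooth : forall p q r,
    smooth_on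
      [set z : 'rV[R]_n * 'rV[R]_n |
        [/\ ccod (chart_at p) z.1, ccod (chart_at q) z.2 &
            cdom (chart_at r)
              (cinv (chart_at p) z.1 * cinv (chart_at q) z.2)%g]]
      (fun z => chart_at r (cinv (chart_at p) z.1 * cinv (chart_at q) z.2)%g);
  lie_inv_smooth : forall p q,
    smooth_on
      [set y | ccod (chart_at p) y /\
               cdom (chart_at q) (cinv (chart_at p) y)^-1%g]
      (fun y => chart_at q (cinv (chart_at p) y)^-1%g)
}.

#[short(type="lieGroupType")]
HB.structure Definition LieGroup (R : realType) (n : nat) :=
  { G of Group G & Topological G & isLieGroup R n G }.

Section LieGroupTheory.
Variables (R : realType) (n : nat) (G : lieGroupType R n).

(* The Lie algebra, i.e. the tangent space at the identity. *)
Local Notation g_ := 'rV[R]_n.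

Definition smooth_fun (f : G -> R) : Prop :=
  forall p : G, smooth_on (ccod (chart_at p))
    (fun y => f (cinv (chart_at p) y) : R^o).

(* Smoothness on the product manifold of [G] and a finite-dimensional [W], the
   latter being read in an arbitrary basis. *)
Definition smooth_fun2 (W : vectType R) (f : G -> W -> R) : Prop :=
  forall p : G, smooth_on
    [set z : 'rV[R]_n * 'rV[R]_(\dim {:W}) | ccod (chart_at p) z.1]
    (fun z => f (cinv (chart_at p) z.1) (passmx.vecof (vbasis {:W}) z.2) : R^o).

Definition tangent_map (f : G -> G) (x : G) (v : 'rV[R]_n) : 'rV[R]_n :=
  'd (chart_at (f x) \o f \o cinv (chart_at x)) (chart_at x x) v.

Definition C1_curve (T : R) (g : R -> G) : Prop :=
  {within `[0, T], continuous g} /\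
  forall (p : G) t, t \in `[0, T] -> cdom (chart_at p) (g t) ->
    derivable_in `[0, T] (chart_at p \o g) t /\
    continuous_in_at `[0, T] (D_in `[0, T] (chart_at p \o g)) t.

Definition velocity (T : R) (g : R -> G) (t : R) : 'rV[R]_n :=
  D_in `[0, T] (chart_at (g t) \o g) t.

(* A tangent vector at [(g t)^-1 * g t = 1]. *)
Definition left_velocity (T : R) (g : R -> G) (t : R) : g_ :=
  tangent_map (fun h => (g t)^-1 * h)%g (g t) (velocity T g t).

(* The left-invariant vector field extending [xi], in the chart at [1]. *)
Definition left_inv_field (xi : g_) (y : 'rV[R]_n) : 'rV[R]_n :=
  let phi := chart_at (1%g : G) in
  'd (fun z => phi (cinv phi y * cinv phi z)%g) (phi 1%g) xi.

Definition lie_bracket (xi eta : g_) : g_ :=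
  let x := chart_at (1%g : G) 1%g in
  'd (left_inv_field eta) x (left_inv_field xi x)
  - 'd (left_inv_field xi) x (left_inv_field eta x).

Definition ad (xi : g_) : 'End(g_) := linfun (lie_bracket xi).

Definition coad (xi : g_) (mu : dual g_) : dual g_ := adjoint (ad xi) mu.

Section Representation.
(* The first two clauses of [smooth_representation] make every [rho g]
   invertible; smoothness is that of the matrix coefficients. *)
Variables (X : vectType R) (rho : G -> 'End(X)).

Definition smooth_representation : Prop :=
  [/\ rho 1%g = \1%VF,
      forall g h : G, rho (g * h)%g = (rho g \o rho h)%VF &
      forall (x : X) (a : dual X), smooth_fun (fun g => a (rho g x))].

Definition drho (xi : g_) : 'End(X) :=
  let phi := chart_at (1%g : G) in
  let b := vbasis {:X} in
  linfun (fun x => passmx.vecof b ('d (fun y => passmx.rVof b (rho (cinv phi y) x))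
                              (phi 1%g) xi)).

Definition momentum (x : X) (a : dual X) : dual g_ :=
  linfun (fun xi => a (drho xi x)).

End Representation.

(* A C^1 curve [e |-> Gam e] in C^1([0, T], G), defined for |e| < d, through
   [g], with fixed end points. *)
Record is_variation (T : R) (g : R -> G) (d : R) (Gam : R -> R -> G) : Prop := {
  var_gt0 : 0 < d;
  var_base : forall t, t \in `[0, T] -> Gam 0 t = g t;
  var_ends : forall e, `|e| < d -> Gam e 0 = g 0 /\ Gam e T = g T;
  var_continuous :
    {within [set z : R * R | `|z.1| < d /\ z.2 \in `[0, T]],
      continuous (fun z => Gam z.1 z.2)};
  var_C1 : forall (p : G) (e t : R),
    let D := [set z : R * R | `|z.1| < d /\ z.2 \in `[0, T]] in
    let y := fun e t => chart_at p (Gam e t) in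
    let dt_y := fun e t => D_in `[0, T] (y e) t in
    D (e, t) -> cdom (chart_at p) (Gam e t) ->
    [/\ derivable_in `[0, T] (y e) t,
        derivable (y^~ t) e 1 &
        derivable (dt_y^~ t) e 1] /\
    [/\ continuous_in_at D (fun z => dt_y z.1 z.2) (e, t),
        continuous_in_at D (fun z => derive1 (y^~ z.2) z.1) (e, t) &
        continuous_in_at D (fun z => derive1 (dt_y^~ z.2) z.1) (e, t)]
}.

Section OptimalControl.
Variables (m : nat) (b : n.-tuple g_) (e0 : g_).

Definition kspace : {vspace g_} := <<take m b>>%VS.
Definition pspace : {vspace g_} := <<drop m b>>%VS.

(* The component in [kspace] along [pspace]. *)
Definition kpart (v : g_) : subvs_of kspace :=
  vsproj kspace (daddv_pi kspace pspace v).

Variable C : G -> subvs_of kspace -> R.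

(* The differential of [C] at [u - e0], extended by zero on [pspace]. *)
Definition dCdu (u : g_) : dual g_ :=
  linfun (fun eta => dirD (C 1%g) (kpart (u - e0)) (kpart eta) : R^o).

Variables (X : vectType R) (Vext : G -> dual X -> R) (alpha0 : dual X).

Definition lagrangian (g : G) (u : g_) (lambda : dual g_) : R :=
  C g (kpart (u - e0)) + Vext g alpha0 + lambda (u - e0).

Definition action (T : R) (lambda : R -> dual g_) (g : R -> G) : R :=
  Rintegral lebesgue_measure `[0, T]
    (fun t => lagrangian (g t) (left_velocity T g t) (lambda t)).

Record normal_extremal (T : R) (g0 gT : G) (g : R -> G) (u : R -> g_)
    (lambda : R -> dual g_) : Prop := {
  ext_C1 : C1_curve T g;
  ext_init : g 0 = g0;
  ext_final : g T = gT;
  ext_control : forall t, t \in `[0, T] -> u t = left_velocity T g t;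
  ext_constraint : forall t, t \in `[0, T] -> u t - e0 \in kspace;
  ext_multiplier_C1 : dual_C1_in `[0, T] lambda;
  ext_multiplier : forall t, t \in `[0, T] ->
    forall xi, xi \in kspace -> lambda t xi = 0;
  ext_stationary : forall (d : R) (Gam : R -> R -> G),
    is_variation T g d Gam ->
    is_derive (0 : R) (1 : R) (fun e => action T lambda (Gam e) : R^o) 0
}.

End OptimalControl.
End LieGroupTheory.

(* Main.v *)
Require Import Defs.
From HB Require Import structures.
From mathcomp Require Import all_boot all_order all_algebra.
From mathcomp Require Import all_classical all_reals all_analysis.
From mathcomp Require Import ring lra.
Import Order.TTheory GRing.Theory Num.Theory.
Import numFieldNormedType.Exports.
Local Open Scope classical_set_scope.
Local Open Scope ring_scope.
Set Implicit Arguments.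
Unset Strict Implicit.
Unset Printing Implicit Defensive.

(** The idea is Euler-Poincare reduction: vary the curve by right
    translations, pull the variation back to the Lie algebra, and read off the
    equation.

    Write [M] for the product of [G] in the chart at the identity and [x0] for
    the coordinates of the identity.  For a direction [eta] and a function [f]
    of class C^1 vanishing at [0] and [T], the [variation] is
    [Gam e t = g t * h], where [h] has coordinates [x0 + e f(t) eta].  It is an
    admissible variation ([variation_is_variation]), its left velocity is an
    explicit expression in the first derivatives of [M]
    ([left_velocity_variation]), and the derivative of that expression at
    [e = 0] is [f' eta + f [u, eta]] ([var_control_derive0]): the classical
    constrained variation.  In coordinates the bracket is the antisymmetrised
    mixed second derivative of [M] ([lie_bracketE]), so this last formula is
    where the symmetry of second derivatives ([schwarz]) is needed.

    Along the variation the cost is [C] at the identity, by left invariance,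
    and the potential is [Vext h alpha(t)] with [alpha(t) = rho_{g(t)}^* alpha0],
    by invariance of [Vext].  Using invariance once more,
    [Vext h alpha = Vext 1 (rho_h^* alpha)], so the derivative of the potential
    at [e = 0] is [f] times the momentum map applied to the gradient of [Vext]
    ([potential_derivative]).  Differentiating the action under the integral
    sign ([is_derive_Rintegral]), stationarity becomes
    [int_0^T f' mu(eta) + f (mu([u, eta]) + J(eta)) dt = 0]
    for all such [f] ([stationary_weak]).  The control [u] is only continuous,
    so the derivative of [mu(eta)] cannot be produced by integrating by parts;
    it is a conclusion of the lemma of du Bois-Reymond ([du_bois_reymond]).

    The equation for [alpha] follows from
    [rho_{g(s)} = rho_{g(t)} rho_{g(t)^-1 g(s)}], since the left velocity is by
    definition the derivative of [g(t)^-1 g(s)] at [s = t]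
    ([advected_is_derive]).

    Two devices carry the regularity bookkeeping.  The relation [dparam] says
    that a function of [(e, t)] is differentiable in [e] with everything
    jointly continuous; it is stable under smooth maps ([dparam_comp]) and
    under [(x, v) |-> 'd f x v] ([dparam_diff]).  Curves given on [[0, T]] only
    are extended to the line through [clamp], and a derivative relative to
    [[0, T]] is an ordinary derivative of the extension by the tangent line
    ([is_derive_inE]). *)

(** * Derivatives of curves, ordinary and relative to a set *)

Section Derivatives.
Variable R : realType.
Implicit Types V W : normedModType R.

(** Difference quotients appear both as functions of the increment and of the
    moving point; this passes from one form to the other. *)
Lemma dnbhs_shift (t : R) : (h *: (1 : R) + t @[h --> (0 : R)^']) = t^'.
Proof.
apply/funext => P; apply/propext.
have E := near_shift (0 : R) t (fun s => s != t -> P s).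
rewrite /dnbhs /within /= /fmap /=.
rewrite [X in _ <-> X]E /=.
rewrite !nbhs_simpl /=.
split => H; apply: filterS H => h /=; rewrite subr0 /GRing.scale /= mulr1.
  by move=> H hN; apply: H; apply: contra_neq hN => ->; rewrite add0r.
move=> H hN; apply: H; apply: contra_neq hN => hE.
by apply: (addIr t); rewrite hE add0r.
Qed.

Lemma is_derive1P W (f : R -> W) (t : R) (l : W) :
  is_derive t (1 : R) f l <->
  (s - t)^-1 *: (f s - f t) @[s --> t^'] --> l.
Proof.
have E : ((s - t)^-1 *: (f s - f t) @[s --> t^'] --> l) =
    (h^-1 *: (f (h *: (1:R) + t) - f t) @[h --> (0:R)^'] --> l).
  rewrite -dnbhs_shift; congr (cvg_to _ _).
  rewrite /= /fmap /=; apply/funext => P /=; congr (within _ _ _).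
  by apply/funext => h /=; rewrite addrK [h *: _]mulr1.
rewrite E; split; first by move=> [D <-]; exact: D.
by move=> H; split; [apply/cvg_ex; exists l|exact/cvg_lim].
Qed.

Lemma is_derive1_continuous W (f : R -> W) (t : R) (l : W) :
  is_derive t (1 : R) f l -> {for t, continuous f}.
Proof.
by case=> /derivable1_diffP d _; exact: differentiable_continuous.
Qed.

Lemma is_derive1_diff W (f : R -> W) (t : R) (l : W) :
  is_derive t (1 : R) f l -> differentiable f t /\ 'd f t 1 = l.
Proof.
move=> [/derivable1_diffP d <-]; split => //.
by rewrite -deriveE.
Qed.

Lemma diff_is_derive1 W (f : R -> W) (t : R) :
  differentiable f t -> is_derive t (1 : R) f ('d f t 1).
Proof.
move=> d; split; last by rewrite deriveE.
exact: diff_derivable.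
Qed.

Lemma is_derive1_comp V W (c : R -> V) (f : V -> W) (t : R) (l : V) :
  is_derive t (1 : R) c l -> differentiable f (c t) ->
  is_derive t (1 : R) (fun s => f (c s)) ('d f (c t) l).
Proof.
move=> /is_derive1_diff[dc <-] df.
have dfc := differentiable_comp dc df.
have := diff_is_derive1 dfc.
by rewrite diff_comp.
Qed.

Lemma is_derive1_pair V W (c : R -> V) (d : R -> W) (t : R) (l : V) (l' : W) :
  is_derive t (1 : R) c l -> is_derive t (1 : R) d l' ->
  is_derive t (1 : R) (fun s => (c s, d s)) (l, l').
Proof.
move=> /is_derive1_diff[dc <-] /is_derive1_diff[dd <-].
have dcd := differentiable_pair dc dd.
have := diff_is_derive1 dcd.
by rewrite diff_pair.
Qed.

Lemma is_derive1_scale W (k : R -> R) (c : R -> W) (t k' : R) (l : W) :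
  is_derive t (1 : R) k k' -> is_derive t (1 : R) c l ->
  is_derive t (1 : R) (fun s => k s *: c s) (k' *: c t + k t *: l).
Proof.
move=> dk dc; apply/is_derive1P.
have ck := is_derive1_continuous dk.
move/is_derive1P : dk => dk; move/is_derive1P : dc => dc.
have -> : (fun s => (s - t)^-1 *: (k s *: c s - k t *: c t)) =
    (fun s => ((s - t)^-1 *: (k s - k t)) *: c t +
              k s *: ((s - t)^-1 *: (c s - c t))).
  apply/funext => s.
  rewrite -[_ *: (k s - k t)]/((s - t)^-1 * (k s - k t)).
  rewrite scalerA [k s * _]mulrC -!scalerA -scalerDr; congr (_ *: _).
  by rewrite scalerBl scalerBr [RHS]addrC subrKA.
apply: cvgD.
  by apply: cvgZ => //; exact: cvg_cst.
apply: cvgZ => //.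
exact: (continuous_withinNx k t).1.
Qed.

Lemma is_derive1_sum W n (h : 'I_n -> R -> W) (t : R) (dh : 'I_n -> W) :
  (forall i, is_derive t (1 : R) (h i) (dh i)) ->
  is_derive t (1 : R) (fun s => \sum_i h i s) (\sum_i dh i).
Proof.
move=> H; have -> : (fun s => \sum_i h i s) = \sum_i h i.
  by apply/funext => s; rewrite fct_sumE.
exact: is_derive_sum.
Qed.

Lemma is_derive_derive1 W (f : R -> W) (t : R) (l : W) :
  is_derive t (1 : R) f l -> derive1 f t = l.
Proof. by move=> [_ <-]; rewrite derive1E. Qed.

Lemma is_derive1_unique W (f : R -> W) (t : R) (l l' : W) :
  is_derive t (1 : R) f l -> is_derive t (1 : R) f l' -> l = l'.
Proof. by move=> [_ <-] [_ <-]. Qed.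

Lemma is_derive1_dir V W (f : V -> W) (x v : V) (t : R) :
  derivable f (x + t *: v) v ->
  is_derive t (1 : R) (fun s => f (x + s *: v)) ('D_v f (x + t *: v)).
Proof.
move=> D; apply/is_derive1P.
rewrite -dnbhs_shift.
rewrite (_ : fmap _ _ = h^-1 *: (f (h *: v + (x + t *: v)) - f (x + t *: v))
  @[h --> (0:R)^']); first exact: D.
rewrite /= /fmap /=; apply/funext => P /=; congr (within _ _ _).
apply/funext => h /=; rewrite addrK [h *: (1:R)]mulr1 scalerDl.
by rewrite addrCA.
Qed.

Section OneSided.
Variable A : set R.

(** Outside [A] the curve is replaced by its tangent line at [t], which turns
    a derivative relative to [A] into an ordinary one. *)
Definition tangent_ext W (f : R -> W) (t : R) (l : W) (s : R) : W :=
  if s \in A then f s else f t + (s - t) *: l.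

Lemma is_derive_inP W (f : R -> W) (t : R) (l : W) : is_derive_in A f t l <->
  forall B, nbhs l B ->
    \forall s \near t, s != t -> A s -> B (diff_quot f t s).
Proof. by split=> H B lB; have := H B lB. Qed.

Lemma is_derive1_nearP W (f : R -> W) (t : R) (l : W) :
  is_derive t (1 : R) f l <->
  forall B, nbhs l B -> \forall s \near t, s != t -> B (diff_quot f t s).
Proof.
split=> [/is_derive1P H B lB|H]; first by have := H B lB.
by apply/is_derive1P => B lB; exact: (H B lB).
Qed.

Lemma tangent_extE W (f : R -> W) t l s : A s -> tangent_ext f t l s = f s.
Proof. by move=> As; rewrite /tangent_ext mem_set. Qed.

(** The difference quotient of the extension is the constant [l] off [A], so
    only the points of [A] matter for the limit.  This gives access to the
    chain rule for ordinary derivatives. *)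
Lemma is_derive_inE W (f : R -> W) (t : R) (l : W) : A t ->
  is_derive_in A f t l <-> is_derive t (1 : R) (tangent_ext f t l) l.
Proof.
move=> At; have Et := tangent_extE f t l At.
have bal (B : set W) : nbhs l B -> B l by exact: nbhs_singleton.
split=> [/is_derive_inP|/is_derive1_nearP] H.
  apply/is_derive1_nearP => B lB; have := H B lB.
  rewrite /diff_quot Et; apply: filterS => s H1 st.
  rewrite {1}/tangent_ext; case: ifPn => [/set_mem As|As]; first exact: H1.
  (* off [A] the quotient is exactly [l] *)
  rewrite [f t + _]addrC addrK scalerA mulVf ?scale1r; first exact: bal.
  by rewrite subr_eq0.
apply/is_derive_inP => B lB; have := H B lB.
rewrite /diff_quot Et; apply: filterS => s H1 st As.
by have := H1 st; rewrite tangent_extE.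
Qed.

Lemma is_derive_is_derive_in W (f : R -> W) (t : R) (l : W) :
  is_derive t (1 : R) f l -> is_derive_in A f t l.
Proof.
move/is_derive1_nearP => H; apply/is_derive_inP => B lB.
by have := H B lB; apply: filterS => s + st _; exact.
Qed.

Lemma is_derive_in_near W (f g : R -> W) (t : R) (l : W) : A t ->
  (\forall s \near t, A s -> f s = g s) ->
  is_derive_in A f t l -> is_derive_in A g t l.
Proof.
move=> At fg; have fgt : f t = g t by move/nbhs_singleton : fg; exact.
move/is_derive_inP => H; apply/is_derive_inP => B lB.
have := H _ lB; rewrite /diff_quot fgt.
apply: filterS2 fg => s fgs H1 st As; move: (H1 st As).
by rewrite fgs.
Qed.

Lemma is_derive_in_eq W (f g : R -> W) (t : R) (l : W) : A t ->
  (forall s, A s -> f s = g s) ->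
  is_derive_in A f t l -> is_derive_in A g t l.
Proof. by move=> At fg; apply: is_derive_in_near => //; exact: filterE. Qed.

Lemma is_derive_in_comp V W (c : R -> V) (f : V -> W) (t : R) (l : V) : A t ->
  is_derive_in A c t l -> differentiable f (c t) ->
  is_derive_in A (fun s => f (c s)) t ('d f (c t) l).
Proof.
move=> At /(is_derive_inE _ _ At) dc df.
have Et := tangent_extE c t l At.
have /is_derive_is_derive_in : is_derive t (1 : R)
    (fun s => f (tangent_ext c t l s)) ('d f (c t) l).
  by rewrite -Et; apply: is_derive1_comp => //; rewrite Et.
apply: is_derive_in_eq => // s As.
by rewrite tangent_extE.
Qed.

Lemma is_derive_in_pair V W (c : R -> V) (d : R -> W) (t : R) (l : V) (l' : W) :
  A t -> is_derive_in A c t l -> is_derive_in A d t l' ->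
  is_derive_in A (fun s => (c s, d s)) t (l, l').
Proof.
move=> At /(is_derive_inE _ _ At) dc /(is_derive_inE _ _ At) dd.
have /is_derive_is_derive_in := is_derive1_pair dc dd.
apply: is_derive_in_eq => // s As.
by rewrite !tangent_extE.
Qed.

Lemma is_derive_in_continuous W (f : R -> W) (t : R) (l : W) : A t ->
  is_derive_in A f t l -> continuous_in_at A f t.
Proof.
move=> At /(is_derive_inE _ _ At) /is_derive1_continuous.
rewrite /prop_for /continuous_at tangent_extE// => H B lB.
have {}H : \forall s \near t, B (tangent_ext f t l s) by exact: H.
suff : \forall s \near t, A s -> B (f s) by [].
apply: filterS H => s + As; rewrite tangent_extE//.
Qed.

End OneSided.

Section Interval.
Variable T : R.
Hypothesis T_gt0 : 0 < T.

(** A point of a nondegenerate interval is a limit of other points of the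
    interval; this is what makes one-sided derivatives unique. *)
Lemma within_itv_proper (t : R) : t \in `[0, T] ->
  ProperFilter (within `[0, T] t^').
Proof.
rewrite in_itv /= => /andP[t0 tT].
apply: Build_ProperFilter_ex => P H.
have {}H : \forall s \near t, s != t -> `[0, T]%classic s -> P s by exact: H.
have [e /= e0 He] := H.
(* a step of at most [T / 2] stays in the interval on one of the two sides *)
have Tn : 0 < Num.min (e / 2) (T / 2) by rewrite lt_min !divr_gt0.
set h := Num.min (e / 2) (T / 2) in Tn *.
have he : h < e by rewrite /h gt_min; apply/orP; left; lra.
have hT : h <= T / 2 by rewrite /h ge_min lexx orbT.
have [tT2|tT2] := leP t (T / 2).
  exists (t + h); apply: (He (t + h)).
  - by rewrite /ball_ /= opprD addNKr normrN gtr0_norm.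
  - by rewrite gt_eqF // ltrDl.
  - by rewrite in_itv /=; apply/andP; split; lra.
exists (t - h); apply: (He (t - h)).
- by rewrite /ball_ /= opprB addrC subrK gtr0_norm.
- by rewrite lt_eqF // ltrBlDr ltrDl.
- by rewrite in_itv /=; apply/andP; split; lra.
Qed.

Lemma is_derive_in_D_in W (f : R -> W) (t : R) (l : W) : t \in `[0, T] ->
  is_derive_in `[0, T] f t l -> D_in `[0, T] f t = l.
Proof.
move=> tT H; have ? := within_itv_proper tT.
exact/cvg_lim.
Qed.

Lemma is_derive_in_unique W (f : R -> W) (t : R) (l l' : W) : t \in `[0, T] ->
  is_derive_in `[0, T] f t l -> is_derive_in `[0, T] f t l' -> l = l'.
Proof. by move=> tT /is_derive_in_D_in <-// /is_derive_in_D_in <-. Qed.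

End Interval.

Lemma derivable_inP W A (f : R -> W) (t : R) :
  derivable_in A f t -> is_derive_in A f t (D_in A f t).
Proof. by []. Qed.

Lemma is_derive_in_derivable W A (f : R -> W) (t : R) (l : W) :
  is_derive_in A f t l -> derivable_in A f t.
Proof. by move=> H; apply/cvg_ex; exists l. Qed.

End Derivatives.

(** * Smooth maps and coordinates *)

Section Smooth.
Variable R : realType.
Implicit Types U V W : normedModType R.

Lemma smooth_on_diff V W (A : set V) (f : V -> W) x :
  smooth_on A f -> A x -> differentiable f x.
Proof. by move=> /(_ 1%N)[+ _]; exact. Qed.

Lemma smooth_on_continuous V W (A : set V) (f : V -> W) x :
  smooth_on A f -> A x -> {for x, continuous f}.
Proof. by move=> /(_ 0%N); exact. Qed.

Lemma smooth_onD V W (A : set V) (f : V -> W) v :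
  smooth_on A f -> smooth_on A ('D_v f).
Proof. by move=> sf k; have [_] := sf k.+1; exact. Qed.

(** A finite basis with continuous coordinate functionals.  The product of two
    spaces of row vectors is not itself a space of row vectors, so finite
    dimension is used in this abstract form. *)
Definition has_coords W := exists N (b : 'I_N -> W) (c : 'I_N -> {linear W -> R^o}),
  (forall i, continuous (c i)) /\ forall v, v = \sum_i c i v *: b i.

Lemma rV_has_coords n : has_coords 'rV[R]_n.
Proof.
have lin i : linear (fun v : 'rV[R]_n => v 0 i : R^o) by move=> k u v; rewrite !mxE.
pose c i : {linear 'rV[R]_n -> R^o} :=
  HB.pack (fun v : 'rV[R]_n => v 0 i : R^o) (GRing.isLinear.Build _ _ _ _ _ (lin i)).
exists n, (fun i => delta_mx 0 i), c; split; first by move=> i; exact: coord_continuous.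
by move=> v; rewrite [LHS]row_sum_delta.
Qed.

Lemma prod_has_coords V W : has_coords V -> has_coords W -> has_coords (V * W)%type.
Proof.
move=> [n [b [c [cc cb]]]] [m [b' [c' [cc' cb']]]].
pose b2 (i : 'I_(n + m)) : V * W :=
  match fintype.split i with inl j => (b j, 0) | inr j => (0, b' j) end.
pose f2 (i : 'I_(n + m)) (z : V * W) : R^o :=
  match fintype.split i with inl j => c j z.1 | inr j => c' j z.2 end.
have lin i : linear (f2 i).
  by move=> k u v; rewrite /f2; case: fintype.split => j; rewrite linearP.
pose c2 i : {linear (V * W)%type -> R^o} :=
  HB.pack (f2 i) (GRing.isLinear.Build _ _ _ _ _ (lin i)).
exists (n + m)%N, b2, c2; split.
  move=> i z; rewrite /c2 /= /f2; case: fintype.split => j.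
    by apply: continuous_comp; [exact: cvg_fst|exact: cc].
  by apply: continuous_comp; [exact: cvg_snd|exact: cc'].
move=> [v w]; rewrite big_split_ord /=.
have fstD k (F : 'I_k -> V * W) : (\sum_i F i).1 = \sum_i (F i).1.
  by apply: (big_morph fst).
have sndD k (F : 'I_k -> V * W) : (\sum_i F i).2 = \sum_i (F i).2.
  by apply: (big_morph snd).
have E1 i : c2 (lshift m i) (v, w) *: b2 (lshift m i) = (c i v *: b i, 0).
  rewrite /c2 /= /f2 /b2 -[lshift m i]/(unsplit (inl i)) unsplitK.
  by rewrite -[RHS]/(c i v *: b i, 0); congr pair; rewrite /= scaler0.
have E2 i : c2 (rshift n i) (v, w) *: b2 (rshift n i) = (0, c' i w *: b' i).
  rewrite /c2 /= /f2 /b2 -[rshift n i]/(unsplit (inr i)) unsplitK.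
  by congr pair; rewrite /= scaler0.
rewrite (eq_bigr _ (fun i _ => E1 i)) [X in _ + X](eq_bigr _ (fun i _ => E2 i)).
rewrite [LHS]surjective_pairing [RHS]surjective_pairing /= !fstD !sndD /=.
by rewrite -cb -cb' !big1// addr0 add0r.
Qed.

Lemma diff_coords V W n (b : 'I_n -> V) (c : 'I_n -> {linear V -> R^o})
    (f : V -> W) x v :
  (forall v, v = \sum_i c i v *: b i) ->
  differentiable f x -> 'd f x v = \sum_i c i v *: 'D_(b i) f x.
Proof.
move=> cb df; rewrite {1}(cb v) linear_sum; apply: eq_bigr => i _.
by rewrite linearZ deriveE.
Qed.

Lemma diff_slice2 U V W (F : U * V -> W) y z : differentiable F (y, z) ->
  differentiable (fun w => F (y, w)) z /\
  forall w, 'd (fun w => F (y, w)) z w = 'd F (y, z) (0, w).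
Proof.
move=> dF.
have d1 : differentiable (fun w : V => (y, w)) z by exact: differentiable_pair.
split; first exact: (@differentiable_comp _ _ _ _ (fun w : V => (y, w))).
move=> w; rewrite (@diff_comp _ _ _ _ (fun w : V => (y, w)))//=.
by rewrite diff_pair// diff_cst diff_val.
Qed.

Lemma diff_slice1 U V W (F : U * V -> W) y z : differentiable F (y, z) ->
  differentiable (fun w => F (w, z)) y /\
  forall w, 'd (fun w => F (w, z)) y w = 'd F (y, z) (w, 0).
Proof.
move=> dF.
have d1 : differentiable (fun w : U => (w, z)) y by exact: differentiable_pair.
split; first exact: (@differentiable_comp _ _ _ _ (fun w : U => (w, z))).
move=> w; rewrite (@diff_comp _ _ _ _ (fun w : U => (w, z)))//=.
by rewrite diff_pair// diff_cst diff_val.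
Qed.

End Smooth.

(** * Symmetry of second derivatives *)

Section Schwarz.
Variable R : realType.
Implicit Types W : normedModType R.

(** Neighbourhoods in the plane contain squares, which is the form used with
    the mean value theorem. *)
Lemma near_plane (x y : R) (P : R * R -> Prop) :
  (\forall z \near (x, y), P z) ->
  exists2 r : R, 0 < r & forall s t, `|s - x| < r -> `|t - y| < r -> P (s, t).
Proof.
move=> /nbhs_ballP[r /= r0 H]; exists r => // s t sx ty; apply: H; split => /=.
  by rewrite -ball_normE /ball_ /= distrC.
by rewrite -ball_normE /ball_ /= distrC.
Qed.

(** The mean value theorem is applied twice: to the difference in direction
    [b] as a function of the step along [a], then to ['D_a f] along [b]. *)
Lemma double_difference W (f : W -> R^o) (x a b : W) (h : R) : 0 < h ->
  (forall s t : R, 0 <= s <= h -> 0 <= t <= h ->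
     derivable f (x + s *: a + t *: b) a /\
     derivable ('D_a f) (x + s *: a + t *: b) b) ->
  exists s t : R, [/\ 0 <= s <= h, 0 <= t <= h &
    f (x + h *: a + h *: b) - f (x + h *: a) - (f (x + h *: b) - f x) =
    h * h * 'D_b ('D_a f) (x + s *: a + t *: b)].
Proof.
move=> h0 H; have hh : 0 <= h <= h by rewrite lexx ltW.
have h00 : 0 <= (0 : R) <= h by rewrite lexx ltW.
pose phi (s : R) : R^o := f (x + h *: b + s *: a) - f (x + s *: a).
have dphi s : 0 <= s <= h -> is_derive s (1 : R) phi
    ('D_a f (x + s *: a + h *: b) - 'D_a f (x + s *: a)).
  move=> sh; apply: is_deriveB.
    rewrite -addrAC; apply: is_derive1_dir.
    by rewrite addrAC; exact: (H s h sh hh).1.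
  apply: is_derive1_dir.
  by have := (H s 0 sh h00).1; rewrite scale0r addr0.
have [||s sh Es] := @MVT_segment _ phi
    (fun s => 'D_a f (x + s *: a + h *: b) - 'D_a f (x + s *: a)) 0 h (ltW h0).
- by move=> s; rewrite in_itv /= => /andP[s0 sh]; apply: dphi; rewrite !ltW.
- apply: derivable_within_continuous => s; rewrite in_itv /= => sh.
  by have [] := dphi _ sh.
move: sh; rewrite in_itv /= => sh.
pose psi (t : R) : R^o := 'D_a f (x + s *: a + t *: b).
have dpsi t : 0 <= t <= h -> is_derive t (1 : R) psi
    ('D_b ('D_a f) (x + s *: a + t *: b)).
  by move=> th; apply: is_derive1_dir; exact: (H s t sh th).2.
have [||t th Et] := @MVT_segment _ psi
    (fun t => 'D_b ('D_a f) (x + s *: a + t *: b)) 0 h (ltW h0).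
- by move=> t; rewrite in_itv /= => /andP[t0 th]; apply: dpsi; rewrite !ltW.
- apply: derivable_within_continuous => t; rewrite in_itv /= => th.
  by have [] := dpsi _ th.
move: th; rewrite in_itv /= => th.
exists s, t; split => //.
move: Et; rewrite /psi scale0r !addr0 subr0 => Et.
move: Es; rewrite /phi scale0r !addr0 subr0 Et => Es.
by rewrite [RHS]mulrC mulrA -Es [x + h *: b + _]addrAC.
Qed.

Lemma dist_le_of_close (p q r e : R) :
  `|p - r| < e / 2 -> `|q - r| < e / 2 -> `|p - q| <= e.
Proof.
rewrite !ltr_norml ler_norml => /andP[? ?] /andP[? ?]; apply/andP; split; lra.
Qed.

(** The double difference is symmetric in [a] and [b], and equals the square
    of the step times either mixed derivative at some nearby point; continuity
    of both at [x] concludes. *)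
Lemma schwarz_scalar W (A : set W) (f : W -> R^o) (x a b : W) :
  open A -> A x ->
  (forall y, A y -> [/\ derivable f y a, derivable f y b,
                        derivable ('D_a f) y b & derivable ('D_b f) y a]) ->
  {for x, continuous ('D_b ('D_a f))} -> {for x, continuous ('D_a ('D_b f))} ->
  'D_b ('D_a f) x = 'D_a ('D_b f) x.
Proof.
move=> oA Ax sf cP cQ.
pose P : W -> R^o := 'D_b ('D_a f); pose Q : W -> R^o := 'D_a ('D_b f).
apply/eqP; rewrite -subr_eq0 -normr_le0; apply/ler_addgt0Pl => e e0; rewrite addr0.
have e20 : 0 < e / 2 by rewrite divr_gt0.
pose g (z : R * R) := x + z.1 *: a + z.2 *: b.
have cg : {for (0, 0), continuous g}.
  apply: cvgD; last by apply: cvgZ; [exact: cvg_snd|exact: cvg_cst].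
  by apply: cvgD; [exact: cvg_cst|apply: cvgZ; [exact: cvg_fst|exact: cvg_cst]].
have g0 : g (0, 0) = x by rewrite /g /= !scale0r !addr0.
have nA : \forall z \near ((0, 0) : R * R), A (g z).
  by apply: cg; rewrite g0; exact: open_nbhs_nbhs.
have n1 (F : W -> R^o) : {for x, continuous F} ->
    \forall z \near ((0, 0) : R * R), `|F x - F (g z)| < e / 2.
  rewrite -g0 => cF.
  have cFg : {for (0, 0), continuous (F \o g)} by exact: (continuous_comp cg).
  by move/cvgrPdist_lt : cFg => /(_ _ e20).
have nP := n1 P cP; have nQ := n1 Q cQ.
have [r r0 Hr] := near_plane (filterI nA (filterI nP nQ)).
pose h := r / 2; have h0 : 0 < h by rewrite divr_gt0.
have inr (s t : R) : 0 <= s <= h -> 0 <= t <= h ->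
    [/\ A (g (s, t)), `|P x - P (g (s, t))| < e / 2 & `|Q x - Q (g (s, t))| < e / 2].
  move=> /andP[s0 sh] /andP[t0 th].
  have [||Ast [Pst Qst]] := Hr s t; last exact: And3 Ast Pst Qst.
    by rewrite subr0 ger0_norm// (le_lt_trans sh)// /h; lra.
  by rewrite subr0 ger0_norm// (le_lt_trans th)// /h; lra.
have D1 (s t : R) : 0 <= s <= h -> 0 <= t <= h ->
    derivable f (x + s *: a + t *: b) a /\
    derivable ('D_a f) (x + s *: a + t *: b) b.
  move=> sh th; have [As _ _] := inr s t sh th.
  by have [d1 d2 d3 d4] := sf _ As; exact: conj d1 d3.
have D2 (s t : R) : 0 <= s <= h -> 0 <= t <= h ->
    derivable f (x + s *: b + t *: a) b /\
    derivable ('D_b f) (x + s *: b + t *: a) a.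
  move=> sh th; have [As _ _] := inr t s th sh; rewrite addrAC.
  by have [d1 d2 d3 d4] := sf _ As; exact: conj d2 d4.
have [s [t [sh th E1]]] := double_difference h0 D1.
have [s' [t' [sh' th' E2]]] := double_difference h0 D2.
have EPQ : P (g (s, t)) = Q (g (t', s')).
  have hh : h * h != 0 by rewrite mulf_neq0 ?gt_eqF.
  apply: (mulfI hh).
  apply: (etrans (esym E1)).
  rewrite [x + h *: b + h *: a]addrAC in E2.
  have -> : g (t', s') = x + s' *: b + t' *: a by rewrite /g /= addrAC.
  apply: (etrans _ E2); move: (f _) (f _) (f _) (f _) => r1 r2 r3 r4.
  by rewrite !opprB addrACA [RHS]addrACA; congr (_ + _); rewrite addrC.
have [_ HP _] := inr s t sh th.
have [_ _ HQ] := inr t' s' th' sh'.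
suff : `|P x - Q x| <= e by [].
rewrite EPQ in HP.
exact: (dist_le_of_close HP HQ).
Qed.

Lemma near_eq_continuous (T : topologicalType) W (f g : T -> W) x :
  (\forall y \near x, f y = g y) -> {for x, continuous f} ->
  {for x, continuous g}.
Proof.
move=> fg; rewrite /prop_for /continuous_at -(nbhs_singleton fg) => cf.
by apply: cvg_trans cf; exact: near_eq_cvg.
Qed.

(** Reduction to the coordinates.  A coordinate of a derivative is the
    derivative of the coordinate only on [A], so every identity is transported
    along neighbourhoods. *)
Lemma schwarz W n (A : set W) (f : W -> 'rV[R]_n) (x a b : W) :
  open A -> A x -> smooth_on A f ->
  'D_b ('D_a f) x = 'D_a ('D_b f) x.
Proof.
move=> oA Ax sf; have sfD c := smooth_onD c sf.
have der (g : W -> 'rV[R]_n) c y : smooth_on A g -> A y -> derivable g y c.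
  by move=> sg Ay; apply: diff_derivable; exact: (smooth_on_diff sg Ay).
have AE y (P : W -> Prop) : A y -> (forall z, A z -> P z) -> \forall z \near y, P z.
  move=> Ay H; have := open_nbhs_nbhs (conj oA Ay).
  by apply: filterS; exact: H.
apply/rowP => j.
pose F (g : W -> 'rV[R]_n) : W -> R^o := fun y => g y 0 j.
have FD g c y : smooth_on A g -> A y -> 'D_c (F g) y = F ('D_c g) y.
  move=> sg Ay; rewrite /F derive_mx; last exact: der.
  by rewrite mxE.
have Fder g c y : smooth_on A g -> A y -> derivable (F g) y c.
  by move=> sg Ay; have /derivable_mxP := der g c y sg Ay; exact.
have Fc g y : smooth_on A g -> A y -> {for y, continuous (F g)}.
  move=> sg Ay; have cg := smooth_on_continuous sg Ay.
  apply: (@continuous_comp _ _ _ g (fun M : 'rV[R]_n => M 0 j) y cg).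
  exact: coord_continuous.
have FDder g c d y : smooth_on A g -> A y -> derivable ('D_c (F g)) y d.
  move=> sg Ay; apply: (@near_eq_derivable _ _ _ (F ('D_c g))).
    by apply: AE => // z Az; rewrite FD.
  by apply: Fder => //; exact: smooth_onD.
have FDD g c d y : smooth_on A g -> A y -> 'D_d ('D_c (F g)) y = F ('D_d ('D_c g)) y.
  move=> sg Ay; rewrite -FD//; last exact: smooth_onD.
  by apply: near_eq_derive; apply: AE => // z Az; rewrite FD.
have FDDc g c d y : smooth_on A g -> A y -> {for y, continuous ('D_d ('D_c (F g)))}.
  move=> sg Ay; apply: (@near_eq_continuous _ _ (F ('D_d ('D_c g)))).
    by apply: AE => // z Az; rewrite FDD.
  by apply: Fc => //; do 2 apply: smooth_onD.
suff E : F ('D_b ('D_a f)) x = F ('D_a ('D_b f)) x by exact: E.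
clearbody F.
apply: (etrans (esym (FDD f a b x sf Ax))).
apply: (etrans _ (FDD f b a x sf Ax)).
apply: (@schwarz_scalar _ A (F f) x a b oA Ax).
- move=> y Ay; have d c := Fder f c y sf Ay; have d' c e := FDder f c e y sf Ay.
  exact: And4 (d a) (d b) (d' a b) (d' b a).
- exact: FDDc f a b x sf Ax.
- exact: FDDc f b a x sf Ax.
Qed.

End Schwarz.

(** * Functions of a parameter and of time *)

Section Dparam.
Variable R : realType.
Implicit Types U V W : normedModType R.

Definition uncurry2 W (E : R -> R -> W) (z : R * R) : W := E z.1 z.2.

(** [E'] is the derivative of [E] with respect to the first variable, near
    [(e, t)], and both are jointly continuous at [(e, t)].  The derivative is
    part of the data so that its value can be computed at [e = 0]. *)
Definition dparam W (E E' : R -> R -> W) (e t : R) : Prop :=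
  [/\ {for (e, t), continuous (uncurry2 E)},
      {for (e, t), continuous (uncurry2 E')} &
      \forall z \near (e, t), is_derive z.1 (1 : R) (E^~ z.2) (E' z.1 z.2)].

Lemma dparam_is_derive W (E E' : R -> R -> W) e t :
  dparam E E' e t -> is_derive e (1 : R) (E^~ t) (E' e t).
Proof. by case=> _ _ /nbhs_singleton. Qed.

Lemma continuous_pair (X Y Z : topologicalType) (f : X -> Y) (g : X -> Z) x :
  {for x, continuous f} -> {for x, continuous g} ->
  {for x, continuous (fun y => (f y, g y))}.
Proof.
move=> cf cg; have : (f y, g y) @[y --> x] --> (f x, g x).
  exact: cvg_pair cf cg.
exact.
Qed.

Lemma near_slice (P : R * R -> Prop) (z : R * R) :
  (\forall w \near z, P w) -> \forall e \near z.1, P (e, z.2).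
Proof.
have c : {for z.1, continuous (fun e : R => (e, z.2))}.
  by apply: continuous_pair; [exact: cvg_id|exact: cvg_cst].
by rewrite {1}(surjective_pairing z) => /c.
Qed.

(** The derivatives in [e] agree because two functions that agree near a point
    of the plane agree on a slice near every nearby point. *)
Lemma dparam_near W (E F E' F' : R -> R -> W) e t :
  (\forall z \near (e, t), E z.1 z.2 = F z.1 z.2) ->
  (\forall z \near (e, t), E' z.1 z.2 = F' z.1 z.2) ->
  dparam E E' e t -> dparam F F' e t.
Proof.
move=> EF EF' [cE cE' dE]; split.
- exact: near_eq_continuous cE.
- exact: near_eq_continuous cE'.
- apply: filterS3 dE EF' (near_join EF) => z dE <- /near_slice /= EFz.
  by apply: near_eq_is_derive dE; exact: EFz.
Qed.

Lemma dparam_of_continuous W (f : R -> W) e t : {for t, continuous f} ->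
  dparam (fun=> f) (fun _ _ => 0) e t.
Proof.
move=> cf; split.
- by apply: (@continuous_comp _ _ _ (snd : R * R -> R) f); [exact: cvg_snd|].
- exact: cvg_cst.
- by apply: filterE => z; exact: is_derive_cst.
Qed.

Lemma dparam_add W (E F E' F' : R -> R -> W) e t :
  dparam E E' e t -> dparam F F' e t ->
  dparam (fun e t => E e t + F e t) (fun e t => E' e t + F' e t) e t.
Proof.
move=> [cE cE' dE] [cF cF' dF]; split.
- exact: cvgD cE cF.
- exact: cvgD cE' cF'.
- apply: filterS2 dE dF => z dE dF; exact: is_deriveD.
Qed.

Lemma dparam_scale W (k k' : R -> R -> R) (E E' : R -> R -> W) e t :
  dparam (k : R -> R -> R^o) k' e t -> dparam E E' e t ->
  dparam (fun e t => k e t *: E e t)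
         (fun e t => k' e t *: E e t + k e t *: E' e t) e t.
Proof.
move=> [ck ck' dk] [cE cE' dE]; split.
- exact: cvgZ ck cE.
- by apply: cvgD; [exact: cvgZ ck' cE|exact: cvgZ ck cE'].
- apply: filterS2 dk dE => z dk dE; exact: is_derive1_scale.
Qed.

Lemma dparam_sum W n (E E' : 'I_n -> R -> R -> W) e t :
  (forall i, dparam (E i) (E' i) e t) ->
  dparam (fun e t => \sum_i E i e t) (fun e t => \sum_i E' i e t) e t.
Proof.
move=> H; split.
- have -> : uncurry2 (fun e t => \sum_i E i e t) = \sum_i uncurry2 (E i).
    by apply/funext => z; rewrite fct_sumE.
  apply: (big_ind (fun f : R * R -> W => {for (e, t), continuous f})).
  + exact: cvg_cst.
  + by move=> f g; exact: cvgD.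
  + by move=> i _; have [] := H i.
- have -> : uncurry2 (fun e t => \sum_i E' i e t) = \sum_i uncurry2 (E' i).
    by apply/funext => z; rewrite fct_sumE.
  apply: (big_ind (fun f : R * R -> W => {for (e, t), continuous f})).
  + exact: cvg_cst.
  + by move=> f g; exact: cvgD.
  + by move=> i _; have [] := H i.
- have : \forall z \near (e, t), forall i,
      is_derive z.1 (1 : R) ((E i)^~ z.2) (E' i z.1 z.2).
    have Hi i : \forall z \near (e, t),
        is_derive z.1 (1 : R) ((E i)^~ z.2) (E' i z.1 z.2).
      by have [] := H i.
    exact: (@filter_forall _ _ (fun i (z : R * R) =>
      is_derive z.1 (1 : R) ((E i)^~ z.2) (E' i z.1 z.2)) (nbhs (e, t)) _ Hi).
  by apply: filterS => z dE; exact: is_derive1_sum.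
Qed.

Lemma dparam_pair V W (E E' : R -> R -> V) (F F' : R -> R -> W) e t :
  dparam E E' e t -> dparam F F' e t ->
  dparam (fun e t => (E e t, F e t)) (fun e t => (E' e t, F' e t)) e t.
Proof.
move=> [cE cE' dE] [cF cF' dF]; split.
- exact: continuous_pair cE cF.
- exact: continuous_pair cE' cF'.
- apply: filterS2 dE dF => z dE dF; exact: is_derive1_pair.
Qed.

Lemma near_in_open W (A : set W) (E : R -> R -> W) e t :
  open A -> A (E e t) -> {for (e, t), continuous (uncurry2 E)} ->
  \forall z \near (e, t), A (E z.1 z.2).
Proof. by move=> oA AE cE; apply: cE; exact: open_nbhs_nbhs (conj oA AE). Qed.

Lemma dparam_lin V W (L : {linear V -> W}) (E E' : R -> R -> V) e t :
  continuous L -> dparam E E' e t ->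
  dparam (fun e t => L (E e t)) (fun e t => L (E' e t)) e t.
Proof.
move=> cL [cE cE' dE]; split.
- by apply: continuous_comp; [exact: cE|exact: cL].
- by apply: continuous_comp; [exact: cE'|exact: cL].
- apply: filterS dE => z dE.
  have dL := linear_differentiable (E z.1 z.2) cL.
  by have := is_derive1_comp dE dL; rewrite diff_lin.
Qed.

(** The new derivative is continuous since ['d f x v] is, in a basis, a finite
    sum of coordinates of [v] times the continuous directional derivatives of
    [f] at [x]. *)
Lemma dparam_comp V W (A : set V) (f : V -> W) (E E' : R -> R -> V) e t :
  has_coords V -> open A -> smooth_on A f -> A (E e t) -> dparam E E' e t ->
  dparam (fun e t => f (E e t)) (fun e t => 'd f (E e t) (E' e t)) e t.
Proof.
move=> [n [b [c [cc cb]]]] oA sf AE [cE cE' dE].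
have nA := near_in_open oA AE cE.
split.
- by apply: continuous_comp; [exact: cE|exact: (smooth_on_continuous sf AE)].
- pose G (z : R * R) := \sum_i c i (E' z.1 z.2) *: 'D_(b i) f (E z.1 z.2).
  apply: (@near_eq_continuous _ _ _ G).
    apply: filterS nA => z Az; rewrite /G /uncurry2 -diff_coords//.
    exact: (smooth_on_diff sf Az).
  have -> : G = \sum_i (fun z => c i (E' z.1 z.2) *: 'D_(b i) f (E z.1 z.2)).
    by apply/funext => z; rewrite fct_sumE.
  apply: (big_ind (fun f : R * R -> W => {for (e, t), continuous f})).
  + exact: cvg_cst.
  + by move=> g g'; exact: cvgD.
  + move=> i _; apply: cvgZ.
      by apply: (@continuous_comp _ _ _ (uncurry2 E') (c i)); [exact: cE'|exact: cc].
    apply: (@continuous_comp _ _ _ (uncurry2 E) ('D_(b i) f)); first exact: cE.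
    exact: (smooth_on_continuous (smooth_onD (b i) sf) AE).
- apply: filterS2 dE nA => z dE Az; apply: is_derive1_comp => //.
  exact: (smooth_on_diff sf Az).
Qed.

(** The differential is linear in the direction, and this survives one more
    differentiation because [A] is open. *)
Lemma second_derivative_coords V W (A : set V) n (b : 'I_n -> V)
    (c : 'I_n -> {linear V -> R^o}) (f : V -> W) x v w :
  (forall v, v = \sum_i c i v *: b i) -> open A -> smooth_on A f -> A x ->
  'D_w ('D_v f) x = \sum_i c i v *: 'd ('D_(b i) f) x w.
Proof.
move=> cb oA sf Ax.
have dD i : differentiable ('D_(b i) f) x.
  exact: (smooth_on_diff (smooth_onD (b i) sf) Ax).
transitivity ('D_w (\sum_i (c i v \*: 'D_(b i) f)) x).
  apply: near_eq_derive.
  have := open_nbhs_nbhs (conj oA Ax); apply: filterS => y Ay.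
  have dy := smooth_on_diff sf Ay.
  by rewrite deriveE// (diff_coords _ cb)// fct_sumE.
rewrite derive_sum; last first.
  by move=> i; apply: derivableZ; exact: diff_derivable.
apply: eq_bigr => i _; rewrite deriveZ; last exact: diff_derivable.
by rewrite deriveE.
Qed.

(** Expanding ['d f x v] in a basis makes it a sum of products of a coordinate
    of [v] with a smooth function of [x]; the product rule then gives a second
    derivative of [f] plus a differential at the derivative of [v]. *)
Lemma dparam_diff U W (A : set U) (f : U -> W) (E E' V V' : R -> R -> U) e t :
  has_coords U -> open A -> smooth_on A f -> A (E e t) ->
  dparam E E' e t -> dparam V V' e t ->
  dparam (fun e t => 'd f (E e t) (V e t))
    (fun e t => 'D_(E' e t) ('D_(V e t) f) (E e t) + 'd f (E e t) (V' e t)) e t.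
Proof.
move=> hU oA sf AE dE dV; have [n [b [c [cc cb]]]] := hU.
have nA := near_in_open oA AE (let: And3 cE _ _ := dE in cE).
have dF i : dparam (fun e t => c i (V e t) *: 'D_(b i) f (E e t))
    (fun e t => c i (V' e t) *: 'D_(b i) f (E e t) +
                c i (V e t) *: 'd ('D_(b i) f) (E e t) (E' e t)) e t.
  apply: dparam_scale; first by apply: dparam_lin => //; exact: cc.
  exact: (dparam_comp hU oA (smooth_onD (b i) sf) AE dE).
apply: dparam_near (dparam_sum dF).
  apply: filterS nA => z Az; rewrite -diff_coords//.
  exact: (smooth_on_diff sf Az).
apply: filterS nA => z Az; rewrite big_split /= -diff_coords//; last first.
  exact: (smooth_on_diff sf Az).
by rewrite (second_derivative_coords _ _ cb oA sf Az) addrC.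
Qed.

End Dparam.

(** * Integrals over an interval and the lemma of du Bois-Reymond *)

Section Integrals.
Variable R : realType.
Local Notation mu := (@lebesgue_measure R).

Lemma continuous_itv_integrable (f : R -> R) (a b : R) : continuous f ->
  mu.-integrable `[a, b] (EFin \o f).
Proof.
move=> cf; apply: continuous_compact_integrable; first exact: segment_compact.
exact: continuous_subspaceT.
Qed.

(** Joint continuity bounds the derivative on a compact rectangle, and this
    constant bound is the integrable majorant. *)
Lemma is_derive_Rintegral (T d : R) (F F' : R -> R -> R^o) : 0 < d ->
  (forall e t, `|e| < d -> dparam F F' e t) ->
  is_derive (0 : R) (1 : R) (fun e => Rintegral mu `[0, T] (F e) : R^o)
    (Rintegral mu `[0, T] (F' 0)).
Proof.
move=> d0 H; pose r := d / 2; have r0 : 0 < r by rewrite divr_gt0.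
have rd : r < d by rewrite /r; lra.
have Ir (e : R) : - r <= e <= r -> `|e| < d.
  by rewrite -ler_norml => er; exact: le_lt_trans rd.
pose K := (`[- r, r]%classic : set R) `*` (`[0, T]%classic : set R).
have cK : compact K by apply: compact_setX; exact: segment_compact.
have cF' : {within K, continuous (uncurry2 F')}.
  apply: continuous_in_subspaceT => -[e t]; rewrite inE => -[/= eK tK].
  have [] // := H e t; apply: Ir; by move: eK; rewrite in_itv.
have := compact_bounded (continuous_compact cF' cK).
move=> [M [Mr HM]].
pose G := fun _ : R => `|M| + 1.
have Gb (e t : R) : `](- r), r[%classic e -> `[0, T]%classic t -> `|F' e t| <= G t.
  move=> er tT; apply: (HM (`|M| + 1)) => //.
    by rewrite (le_lt_trans (ler_norm M))// ltrDl.
  exists (e, t) => //; split => //=.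
  by move: er; rewrite /= !in_itv /= => /andP[/ltW -> /ltW ->].
have dFe (e t : R) : `](- r), r[%classic e -> `[0, T]%classic t ->
    is_derive e (1 : R) (F^~ t) (F' e t).
  move=> er tT; apply: dparam_is_derive; apply: H; apply: Ir.
  by move: er; rewrite /= !in_itv /= => /andP[/ltW -> /ltW ->].
have I0 : (`](- r), r[%classic : set R) 0 by rewrite /= in_itv /= r0 oppr_lt0 r0.
have intF (e : R) : `](- r), r[%classic e -> mu.-integrable `[0, T] (EFin \o F e).
  rewrite /= in_itv /= => /andP[er1 er2].
  apply: continuous_itv_integrable => t.
  have [] := H e t; first by apply: Ir; rewrite !ltW.
  move=> cF _ _.
  apply: (@continuous_comp _ _ _ (fun t : R => (e, t)) (uncurry2 F)) => //.
  by apply: continuous_pair; [exact: cvg_cst|exact: cvg_id].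
have intG : mu.-integrable `[0, T] (EFin \o G).
  by apply: continuous_itv_integrable; exact: cst_continuous.
have G0 (y : R) : 0 <= G y by rewrite addr_ge0.
have derF (e t : R) : `](- r), r[%classic e -> `[0, T]%classic t -> derivable (F^~ t) e 1.
  by move=> er tT; have [] := dFe e t er tT.
have GF (e t : R) : `](- r), r[%classic e -> `[0, T]%classic t ->
    `|derive1 (F^~ t) e| <= G t.
  by move=> er tT; rewrite (is_derive_derive1 (dFe e t er tT)); exact: Gb.
have mT : measurable (`[0, T]%classic : set (measurableTypeR R)) by exact: measurable_itv.
split.
  exact: (derivable_under_integral mT I0 intF derF G0 intG GF).
rewrite -derive1E.
rewrite (differentiation_under_integral mT I0 intF derF G0 intG GF).
apply: eq_Rintegral => t; rewrite inE => tT.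
exact: (is_derive_derive1 (dFe 0 t I0 tT)).
Qed.

(** The integral starts at [-1] and not at [0] so that [0] is interior and the
    derivative at both end points is two-sided. *)
Lemma antiderivative (T : R) (h : R -> R) : 0 < T -> continuous h ->
  exists2 H : R -> R, H 0 = 0 &
    forall t : R, t \in `[0, T] -> is_derive t (1 : R) (H : R -> R^o) (h t).
Proof.
move=> T0 ch.
pose K (x : R) := Rintegral mu `[-1, x] h.
exists (fun x => K x - K 0); first by rewrite subrr.
move=> t; rewrite in_itv /= => /andP[t0 tT].
have [||||] := @continuous_FTC1_closed _ h (-1) t (T + 1).
- by rewrite (le_lt_trans tT)// ltrDl.
- exact: continuous_itv_integrable.
- by rewrite (lt_le_trans _ t0).
- exact: ch.
move=> dK Kt; rewrite -[h t]subr0; apply: is_deriveB.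
by split; [exact: dK|rewrite -derive1E; exact: Kt].
Qed.

Lemma Rintegral_derivative (T : R) (h H : R -> R) : 0 < T ->
  {in `[0, T], continuous h} ->
  (forall t : R, t \in `[0, T] -> is_derive t (1 : R) (H : R -> R^o) (h t)) ->
  Rintegral mu `[0, T] h = H T - H 0.
Proof.
move=> T0 ch dH; rewrite /Rintegral.
have itvT t : t \in `]0, T[ -> t \in `[0, T] by apply: subset_itv_oo_cc.
have I0 : 0 \in `[0, T] by rewrite in_itv /= lexx ltW.
have IT : T \in `[0, T] by rewrite in_itv /= lexx ltW.
rewrite (@continuous_FTC2 _ h H)//.
- by apply: continuous_in_subspaceT => t; rewrite inE; exact: ch.
- split.
  + by move=> t tT; have [] := dH t (itvT t tT).
  + apply: cvg_at_right_filter; exact: is_derive1_continuous (dH 0 I0).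
  + apply: cvg_at_left_filter; exact: is_derive1_continuous (dH T IT).
- by move=> t tT; apply: is_derive_derive1; apply: dH; exact: itvT.
Qed.

(** The nearest point of [[0, T]]; precomposing with it extends a function
    given on [[0, T]] to the whole line. *)
Definition clamp (T t : R) : R := Num.max 0 (Num.min t T).

Lemma clamp_in (T t : R) : 0 < T -> clamp T t \in `[0, T].
Proof.
by move=> T0; rewrite in_itv /= /clamp le_max lexx /= ge_max ltW//= ge_min lexx orbT.
Qed.

Lemma clampE (T t : R) : t \in `[0, T] -> clamp T t = t.
Proof. by rewrite in_itv /= /clamp => /andP[t0 tT]; rewrite min_l// max_r. Qed.

Lemma clamp_continuous (T : R) : continuous (clamp T).
Proof.
move=> t.
apply: (@continuous_max _ _ (cst 0) (fun s : R => Num.min s T : R^o) t).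
  exact: cvg_cst.
by apply: (@continuous_min _ _ id (cst T) t); [exact: cvg_id|exact: cvg_cst].
Qed.

Lemma nondecreasing_of_derive (x y : R) (P p : R -> R) : x <= y ->
  (forall t : R, t \in `[x, y] -> is_derive t (1 : R) (P : R -> R^o) (p t)) ->
  (forall t : R, 0 <= p t) -> P x <= P y.
Proof.
move=> xy dP p0.
have dP' t : t \in `]x, y[ -> is_derive t (1 : R) (P : R -> R^o) (p t).
  by move=> txy; apply: dP; exact: subset_itv_oo_cc.
have cP : {within `[x, y], continuous P}.
  by apply: derivable_within_continuous => t txy; have [] := dP t txy.
have [t txy E] := MVT_segment xy dP' cP.
by rewrite -subr_ge0 E mulr_ge0 ?subr_ge0.
Qed.

(** With [B] an antiderivative of [b] and [c] the mean of [a - B], the test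
    function whose derivative is [a - B - c] vanishes at both ends.  For it
    the hypothesis reduces, the boundary terms being zero, to the vanishing of
    the integral of [(a - B - c)^2], hence [a = B + c]. *)
Lemma du_bois_reymond (T : R) (a b : R -> R) : 0 < T ->
  continuous a -> continuous b ->
  (forall f f' : R -> R, continuous f' ->
     (forall t : R, t \in `[0, T] -> is_derive t (1 : R) (f : R -> R^o) (f' t)) ->
     f 0 = 0 -> f T = 0 ->
     Rintegral mu `[0, T] (fun t => f' t * a t + f t * b t) = 0) ->
  forall t : R, t \in `[0, T] -> is_derive_in `[0, T] (a : R -> R^o) t (b t).
Proof.
move=> T0 ca cb H.
have [B B0 dB] := antiderivative T0 cb.
pose Bc t := B (clamp T t).
have cBc : continuous Bc.
  move=> t; apply: continuous_comp; first exact: clamp_continuous.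
  exact: is_derive1_continuous (dB _ (clamp_in t T0)).
have [Q Q0 dQ] : exists2 Q : R -> R, Q 0 = 0 &
    forall t : R, t \in `[0, T] -> is_derive t (1 : R) (Q : R -> R^o) (a t - Bc t).
  by apply: antiderivative => // t; apply: cvgB; [exact: ca|exact: cBc].
(* [c] is the mean of [a - B], so that [f] vanishes at [T] *)
pose c := Q T / T.
pose f (t : R) : R := Q t - c * t.
pose f' (t : R) : R := a t - Bc t - c.
have cf' : continuous f'.
  by move=> t; apply: cvgB; [apply: cvgB; [exact: ca|exact: cBc]|exact: cvg_cst].
have df (t : R) : t \in `[0, T] -> is_derive t (1 : R) (f : R -> R^o) (f' t).
  move=> tT; apply: is_deriveB; first exact: dQ.
  have := is_deriveZ c (is_derive_id t (1 : R)).
  by rewrite [c *: 1]mulr1.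
have f0 : f 0 = 0 by rewrite /f Q0 mulr0 subrr.
have fT : f T = 0 by rewrite /f /c mulfVK ?gt_eqF ?subrr.
have cf (t : R) : t \in `[0, T] -> {for t, continuous f}.
  by move=> tT; exact: is_derive1_continuous (df t tT).
have [P P0 dP] : exists2 P : R -> R, P 0 = 0 &
    forall t : R, t \in `[0, T] -> is_derive t (1 : R) (P : R -> R^o) (f' t * f' t).
  by apply: antiderivative => // t; apply: cvgM; exact: cf'.
(* [S] is an antiderivative of the integrand in the hypothesis *)
pose S (t : R) : R := P t + (f t * B t + c * f t).
have dS (t : R) : t \in `[0, T] ->
    is_derive t (1 : R) (S : R -> R^o) (f' t * a t + f t * b t).
  move=> tT.
  have dfB := is_derive1_scale (df t tT) (dB t tT).
  have dcf := is_deriveZ c (df t tT).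
  have dsum := is_deriveD (dP t tT) (is_deriveD dfB dcf).
  apply: is_derive_eq dsum _.
  have BE : B t = Bc t by rewrite /Bc clampE.
  rewrite /GRing.scale /= BE /f'; ring.
have I0 : 0 \in `[0, T] by rewrite in_itv /= lexx ltW.
have IT : T \in `[0, T] by rewrite in_itv /= lexx ltW.
have PT : P T = 0.
  have := H f f' cf' df f0 fT.
  rewrite (Rintegral_derivative T0 _ dS).
    by rewrite /S f0 fT P0 !mul0r mulr0 !addr0 subr0.
  move=> t tT; apply: cvgD.
    by apply: cvgM; [exact: cf'|exact: ca].
  by apply: cvgM; [exact: cf|exact: cb].
(* [P] is nondecreasing with equal values at the ends, hence constant, and its
   derivative is a square *)
have Pmono (x y : R) : x \in `[0, T] -> y \in `[0, T] -> x <= y -> P x <= P y.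
  move=> xT yT xy; have sub (z : R) : z \in `[x, y] -> z \in `[0, T].
    move: xT yT; rewrite !in_itv /= => /andP[x0 _] /andP[_ yT] /andP[xz zy].
    by rewrite (le_trans x0 xz) (le_trans zy yT).
  have dPs (t : R) : t \in `[x, y] ->
      is_derive t (1 : R) (P : R -> R^o) (f' t * f' t).
    by move=> txy; apply: dP; exact: sub.
  have p0 (t : R) : 0 <= f' t * f' t by rewrite -expr2 sqr_ge0.
  clearbody f'.
  exact: (@nondecreasing_of_derive x y P (fun t => f' t * f' t) xy dPs p0).
have PE (t : R) : t \in `[0, T] -> P t = 0.
  move=> tT; have := tT; rewrite in_itv /= => /andP[t0 tT'].
  have h1 := Pmono t T tT IT tT'; have h2 := Pmono 0 t I0 tT t0.
  by apply/le_anti; rewrite PT in h1; rewrite P0 in h2; rewrite h1 h2.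
have aE (t : R) : t \in `[0, T] -> a t = B t + c.
  move=> tT.
  have d1 := is_derive_is_derive_in `[0, T]%classic (dP t tT).
  have d2 : is_derive_in `[0, T] (P : R -> R^o) t 0.
    apply: (@is_derive_in_eq _ _ _ (cst (0 : R^o))) => //.
      by move=> s sT; rewrite PE.
    by apply: is_derive_is_derive_in; exact: is_derive_cst.
  have := is_derive_in_unique T0 tT d1 d2.
  move/eqP; rewrite mulf_eq0 orbb /f' /Bc clampE// => /eqP.
  by move/eqP; rewrite subr_eq0 subr_eq addrC => /eqP.
move=> t tT.
apply: (@is_derive_in_eq _ _ _ (fun s => B s + c : R^o)) => //.
  by move=> s sT; rewrite aE.
apply: is_derive_is_derive_in; rewrite -[b t]addr0.
by apply: is_deriveD; exact: dB.
Qed.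

End Integrals.

(** * The group operations in charts *)

Section Charts.
Variables (R : realType) (n : nat) (G : lieGroupType R n).
Implicit Types (p q r a : G) (y z : 'rV[R]_n).
Local Notation phi := (chart_at (1%g : G)).
Local Notation x0 := (chart_at (1%g : G) 1%g).

Definition chart_mul p q r (z : 'rV[R]_n * 'rV[R]_n) : 'rV[R]_n :=
  chart_at r (cinv (chart_at p) z.1 * cinv (chart_at q) z.2)%g.

Definition chart_mul_dom p q r : set ('rV[R]_n * 'rV[R]_n) :=
  [set z | [/\ ccod (chart_at p) z.1, ccod (chart_at q) z.2 &
     cdom (chart_at r) (cinv (chart_at p) z.1 * cinv (chart_at q) z.2)%g]].

Lemma chart_mul_smooth p q r : smooth_on (chart_mul_dom p q r) (chart_mul p q r).
Proof. exact: lie_mul_smooth. Qed.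

Lemma open_near (X : topologicalType) (A : set X) :
  (forall x, A x -> \forall y \near x, A y) -> open A.
Proof. by move=> H; rewrite openE => x /H. Qed.

Lemma mulg_continuous_at (X : topologicalType) (a b : X -> G) x :
  {for x, continuous a} -> {for x, continuous b} ->
  {for x, continuous (fun s => a s * b s)%g}.
Proof.
move=> ca cb.
apply: (@continuous_comp _ _ _ (fun s => (a s, b s)) (fun z : G * G => (z.1 * z.2)%g)).
  exact: continuous_pair.
exact: lie_mul_continuous.
Qed.

Lemma chart_mul_dom_open p q r : open (chart_mul_dom p q r).
Proof.
apply: open_near => -[y z] [/= py qz rm].
have cp : {for (y, z), continuous (fun w : 'rV[R]_n * 'rV[R]_n => cinv (chart_at p) w.1)}.
  apply: (@continuous_comp _ _ _ fst (cinv (chart_at p))); first exact: cvg_fst.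
  exact: cinv_continuous.
have cq : {for (y, z), continuous (fun w : 'rV[R]_n * 'rV[R]_n => cinv (chart_at q) w.2)}.
  apply: (@continuous_comp _ _ _ snd (cinv (chart_at q))); first exact: cvg_snd.
  exact: cinv_continuous.
have np : \forall w \near (y, z), ccod (chart_at p) w.1.
  have c1 : {for (y, z), continuous (fst : 'rV[R]_n * 'rV[R]_n -> _)} by exact: cvg_fst.
  exact: c1 _ (open_nbhs_nbhs (conj (@ccod_open _ _ _ (chart_at p)) py)).
have nq : \forall w \near (y, z), ccod (chart_at q) w.2.
  have c1 : {for (y, z), continuous (snd : 'rV[R]_n * 'rV[R]_n -> _)} by exact: cvg_snd.
  exact: c1 _ (open_nbhs_nbhs (conj (@ccod_open _ _ _ (chart_at q)) qz)).
have nr := mulg_continuous_at cp cq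
  (open_nbhs_nbhs (conj (@cdom_open _ _ _ (chart_at r)) rm)).
by apply: filterS3 np nq nr => w pw qw rw; split.
Qed.

Lemma chart_near_dom (X : topologicalType) (a : X -> G) p x :
  {for x, continuous a} -> cdom (chart_at p) (a x) ->
  \forall s \near x, cdom (chart_at p) (a s).
Proof.
move=> ca pa.
by exact: ca _ (open_nbhs_nbhs (conj (@cdom_open _ _ _ (chart_at p)) pa)).
Qed.

Lemma chart_continuous_at (X : topologicalType) (a : X -> G) p x :
  {for x, continuous a} -> cdom (chart_at p) (a x) ->
  {for x, continuous (fun s => chart_at p (a s))}.
Proof.
move=> ca pa; apply: (@continuous_comp _ _ _ a (chart_at p)) => //.
exact: cmap_continuous.
Qed.

Lemma unit_cod : ccod phi x0.
Proof. by apply: cmap_cod; exact: mem_chart_at. Qed.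

Lemma cinv_x0 : cinv phi x0 = 1%g.
Proof. by apply: cmapK; exact: mem_chart_at. Qed.

(** The inverse, in the chart at the identity; the group inverse of a point of
    the chart may leave it, which [chart_inv_dom] rules out. *)
Definition chart_inv y : 'rV[R]_n := phi (cinv phi y)^-1%g.

Definition chart_inv_dom : set 'rV[R]_n :=
  [set y | ccod phi y /\ cdom phi (cinv phi y)^-1%g].

Lemma chart_inv_smooth : smooth_on chart_inv_dom chart_inv.
Proof. exact: lie_inv_smooth. Qed.

Lemma chart_inv_dom_open : open chart_inv_dom.
Proof.
apply: open_near => y [cy iy].
have ci : {for y, continuous (fun y => (cinv phi y)^-1%g)}.
  apply: (@continuous_comp _ _ _ (cinv phi) (fun x : G => x^-1%g)).
    exact: cinv_continuous.
  exact: lie_inv_continuous.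
have ny := chart_near_dom ci iy.
have nc : \forall z \near y, ccod phi z.
  exact: (open_nbhs_nbhs (conj (@ccod_open _ _ _ phi) cy)).
by apply: filterS2 nc ny => z ? ?; split.
Qed.

Lemma unit_inv_dom : chart_inv_dom x0.
Proof. split; first exact: unit_cod. by rewrite cinv_x0 invg1; exact: mem_chart_at. Qed.

Lemma cinv_chart_inv y : chart_inv_dom y -> cinv phi (chart_inv y) = (cinv phi y)^-1%g.
Proof. by move=> [_ iy]; rewrite /chart_inv cmapK. Qed.

Lemma chart_inv_cod y : chart_inv_dom y -> ccod phi (chart_inv y).
Proof. by move=> [_ iy]; exact: cmap_cod. Qed.

Local Notation M := (chart_mul 1%g 1%g 1%g).
Local Notation Mdom := (chart_mul_dom 1%g 1%g 1%g).

Lemma chart_mul_dom_1l z : ccod phi z -> Mdom (x0, z).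
Proof.
by move=> cz; split => //=; [exact: unit_cod|rewrite cinv_x0 mul1g; exact: cinv_dom].
Qed.

Lemma chart_mul_dom_1r z : ccod phi z -> Mdom (z, x0).
Proof.
by move=> cz; split => //=; [exact: unit_cod|rewrite cinv_x0 mulg1; exact: cinv_dom].
Qed.

Lemma chart_mul_dom_invl z : chart_inv_dom z -> Mdom (chart_inv z, z).
Proof.
move=> iz; split => /=; [exact: chart_inv_cod|by case: iz|].
by rewrite cinv_chart_inv// mulVg; exact: mem_chart_at.
Qed.

Lemma chart_mul_1l z : ccod phi z -> M (x0, z) = z.
Proof. by move=> cz; rewrite /chart_mul /= cinv_x0 mul1g cinvK. Qed.

Lemma chart_mul_1r z : ccod phi z -> M (z, x0) = z.
Proof. by move=> cz; rewrite /chart_mul /= cinv_x0 mulg1 cinvK. Qed.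

Lemma chart_mul_invl z : chart_inv_dom z -> M (chart_inv z, z) = x0.
Proof. by move=> iz; rewrite /chart_mul /= cinv_chart_inv// mulVg. Qed.

Lemma near_cod z : ccod phi z -> \forall w \near z, ccod phi w.
Proof. by move=> cz; exact: (open_nbhs_nbhs (conj (@ccod_open _ _ _ phi) cz)). Qed.

End Charts.

(** * Differentials of locally equal maps, linearity *)

Section NearDiff.
Variable R : realType.
Implicit Types V W : normedModType R.

(** The differential is chosen from the first-order expansion, which depends
    only on the germ of the map. *)
Lemma near_eq_differentiable V W (f g : V -> W) x :
  (\forall y \near x, f y = g y) -> differentiable g x ->
  differentiable f x /\ 'd f x = 'd g x :> (V -> W).
Proof.
move=> fg dg; have fgx := nbhs_singleton fg.
have cdg : continuous ('d g x) by exact: diff_continuous.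
have E : f \o shift x = cst (f x) + 'd g x +o_ (0 : V) id.
  apply/eqaddoP => e e0.
  have /eqaddoP/(_ e e0) := diff_locally dg.
  have fg0 : \forall h \near (0 : V), f (h + x) = g (h + x).
    have := near_shift (0 : V) x (fun y => f y = g y); rewrite subr0 => <-.
    exact: fg.
  apply: filterS2 fg0 => h fgh.
  rewrite -[(f \o _ - _) h]/(f (h + x) - (f x + 'd g x h)).
  by rewrite -[(g \o _ - _) h]/(g (h + x) - (g x + 'd g x h)) fgh fgx.
have dE := diff_unique cdg E.
split; last exact: dE.
by apply/diff_locallyP; rewrite dE; split; [exact: cdg|exact: E].
Qed.

Lemma diff_near_id V (f : V -> V) z v :
  (\forall y \near z, f y = y) -> 'd f z v = v.
Proof.
move=> nE; have did : differentiable (@id V) z by exact: ex_diff.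
by have [_ ->] := near_eq_differentiable nE did; rewrite diff_val.
Qed.

Lemma diff_left_inverse V W (f : V -> W) (g : W -> V) z x v : f z = x ->
  differentiable f z -> differentiable g x ->
  (\forall y \near z, g (f y) = y) -> 'd g x ('d f z v) = v.
Proof.
move=> fz df dg nE; rewrite -fz in dg *.
have E := diff_comp df dg.
have : 'd (g \o f) z v = v by exact: diff_near_id nE.
by rewrite E.
Qed.

(** The definitions of [ad], [drho], [momentum] and [dCdu] all go through
    [linfun], which returns the given function only when it is linear. *)
Lemma linfunE_of_linear (K : fieldType) (aT rT : vectType K) (f : aT -> rT) v :
  linear f -> linfun f v = f v.
Proof.
move=> lf.
pose fl : {linear aT -> rT} := HB.pack f (GRing.isLinear.Build _ _ _ _ _ lf).
by rewrite -[f]/(fl : aT -> rT) lfunE.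
Qed.

Lemma second_derivative_linear_inner V W (A : set V) (f : V -> W) x w : has_coords V ->
  open A -> smooth_on A f -> A x -> linear (fun v => 'D_w ('D_v f) x).
Proof.
move=> [N [b [c [_ cb]]]] oA sf Ax k u v.
rewrite !(second_derivative_coords _ _ cb oA sf Ax) scaler_sumr -big_split.
apply: eq_bigr => i _.
by rewrite linearP scalerDl scalerA.
Qed.

Lemma second_derivative_linear_outer V W (A : set V) (f : V -> W) x v :
  smooth_on A f -> A x -> linear (fun w => 'D_w ('D_v f) x).
Proof.
move=> sf Ax k u w; have d := smooth_on_diff (smooth_onD v sf) Ax.
by rewrite !deriveE// linearP.
Qed.

End NearDiff.

(** * The Lie bracket in the chart at the identity *)

Section ChartCalculus.
Variables (R : realType) (n : nat) (G : lieGroupType R n).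
Implicit Types (p q r a : G) (y z v w xi eta : 'rV[R]_n).
Local Notation phi := (chart_at (1%g : G)).
Local Notation x0 := (chart_at (1%g : G) 1%g).
Local Notation M := (chart_mul (1%g : G) 1%g 1%g).
Local Notation Mdom := (chart_mul_dom (1%g : G) 1%g 1%g).

Lemma chart_mul_diff (z : 'rV[R]_n * 'rV[R]_n) : Mdom z -> differentiable M z.
Proof. exact: (smooth_on_diff (@chart_mul_smooth _ _ G _ _ _)). Qed.

Lemma chart_mul_D_diff (u z : 'rV[R]_n * 'rV[R]_n) : Mdom z -> differentiable ('D_u M) z.
Proof. exact: (smooth_on_diff (smooth_onD u (@chart_mul_smooth _ _ G _ _ _))). Qed.

Lemma diff_chart_mul_1l z w : ccod phi z -> 'd M (x0, z) (0, w) = w.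
Proof.
move=> cz; have [d1 <-] := diff_slice2 (chart_mul_diff (chart_mul_dom_1l cz)).
have nE : \forall y \near z, M (x0, y) = id y.
  by have := near_cod cz; apply: filterS => y cy; rewrite chart_mul_1l.
exact: diff_near_id nE.
Qed.

Lemma diff_chart_mul_1r z w : ccod phi z -> 'd M (z, x0) (w, 0) = w.
Proof.
move=> cz; have [d1 <-] := diff_slice1 (chart_mul_diff (chart_mul_dom_1r cz)).
have nE : \forall y \near z, M (y, x0) = id y.
  by have := near_cod cz; apply: filterS => y cy; rewrite chart_mul_1r.
exact: diff_near_id nE.
Qed.

Lemma near_chart_mul_dom y z : Mdom (y, z) -> \forall w \near z, Mdom (y, w).
Proof.
move=> Myz; have c : {for z, continuous (fun w => (y, w))}.
  have c1 : {for z, continuous (fun _ : 'rV[R]_n => y)} by exact: cst_continuous.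
  have c2 : {for z, continuous (fun w : 'rV[R]_n => w)} by exact: cvg_id.
  exact: (continuous_pair c1 c2).
exact: c _ (open_nbhs_nbhs (conj (@chart_mul_dom_open _ _ G _ _ _) Myz)).
Qed.

Lemma cinv_chart_mul (z : 'rV[R]_n * 'rV[R]_n) : Mdom z ->
  cinv phi (M z) = (cinv phi z.1 * cinv phi z.2)%g.
Proof. by move=> [_ _ Mz]; rewrite /chart_mul cmapK. Qed.

(** Left translation by a group element undoes left translation by its
    inverse; this is the derivative of that identity.  It determines the
    velocity of the product curve without inverting a matrix. *)
Lemma diff_chart_mul_invl z v : chart_inv_dom G z ->
  'd M (z, x0) (0, 'd M (chart_inv G z, z) (0, v)) = v.
Proof.
move=> iz; have cz : ccod phi z by case: iz.
have [d1 E1] := diff_slice2 (chart_mul_diff (chart_mul_dom_invl iz)).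
have M0 : M (chart_inv G z, z) = x0 by exact: chart_mul_invl.
have [d2 E2] := diff_slice2 (chart_mul_diff (chart_mul_dom_1r cz)).
have nE : \forall y \near z, M (z, M (chart_inv G z, y)) = y.
  apply: filterS2 (near_cod cz) (near_chart_mul_dom (chart_mul_dom_invl iz)) => y cy My.
  by rewrite {1}/chart_mul /= cinv_chart_mul//= cinv_chart_inv// mulgA mulgV mul1g cinvK.
have K := diff_left_inverse v M0 d1 d2 nE.
have K1 := etrans (congr1 _ (esym (E1 v))) K.
exact: etrans (esym (E2 _)) K1.
Qed.

(** Differentiating the product in its second argument only is a directional
    derivative of [M]; this form is smooth in [y]. *)
Lemma left_inv_fieldE xi y : ccod phi y ->
  left_inv_field G xi y = 'D_(0, xi) M (y, x0).
Proof.
move=> cy; have d := chart_mul_diff (chart_mul_dom_1r cy).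
have [_ E] := diff_slice2 d.
by rewrite deriveE// -E.
Qed.

Lemma diff_left_inv_field xi eta :
  'd (left_inv_field G eta) x0 xi = 'D_(xi, 0) ('D_(0, eta) M) (x0, x0).
Proof.
have c0 := unit_cod G; have d := chart_mul_D_diff (0, eta) (chart_mul_dom_1l c0).
have nE : \forall y \near x0, left_inv_field G eta y = 'D_(0, eta) M (y, x0).
  by apply: filterS (near_cod c0) => y; exact: left_inv_fieldE.
have [d1 E] := diff_slice1 d.
by have [_ ->] := near_eq_differentiable nE d1; rewrite E deriveE.
Qed.

(** The value of a left-invariant field at the identity is the vector itself,
    so the bracket of vector fields reduces to the two mixed second
    derivatives of the product. *)
Lemma lie_bracketE xi eta : lie_bracket G xi eta =
  ('D_(xi, 0) ('D_(0, eta) M) (x0, x0) : 'rV[R]_n) -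
  ('D_(eta, 0) ('D_(0, xi) M) (x0, x0) : 'rV[R]_n).
Proof.
have E zeta : left_inv_field G zeta x0 = zeta.
  have c0 := unit_cod G; rewrite left_inv_fieldE// deriveE ?diff_chart_mul_1l//.
  exact: chart_mul_diff (chart_mul_dom_1l c0).
have -> : lie_bracket G xi eta =
    'd (left_inv_field G eta) x0 (left_inv_field G xi x0) -
    'd (left_inv_field G xi) x0 (left_inv_field G eta x0) by [].
have K (a b : 'rV[R]_n) : 'd (left_inv_field G b) x0 (left_inv_field G a x0) =
    'D_(a, 0) ('D_(0, b) M) (x0, x0).
  by apply: etrans (diff_left_inv_field a b); congr ('d _ _ _); exact: E.
have sub_congr (a b c d : 'rV[R]_n) : a = c -> b = d -> a - b = c - d.
  by move=> -> ->.
apply: sub_congr; [exact: K xi eta|exact: K eta xi].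
Qed.

Lemma lie_bracket_linear xi : linear (lie_bracket G xi).
Proof.
have [B [B1 B2 BE]] : exists B : 'rV[R]_n * 'rV[R]_n -> 'rV[R]_n * 'rV[R]_n -> 'rV[R]_n,
    [/\ forall d : 'rV[R]_n * 'rV[R]_n, linear (B^~ d),
        forall d : 'rV[R]_n * 'rV[R]_n, linear (B d) &
     forall xi eta, lie_bracket G xi eta = B (0, eta) (xi, 0) - B (0, xi) (eta, 0)].
  have M0 := chart_mul_dom_1l (unit_cod G).
  have sM := @chart_mul_smooth _ _ G 1%g 1%g 1%g.
  have hc := prod_has_coords (rV_has_coords R n) (rV_has_coords R n).
  exists (fun c d => 'D_d ('D_c M) (x0, x0)); split; last exact: lie_bracketE.
    move=> d.
    exact: (second_derivative_linear_inner d hc (@chart_mul_dom_open _ _ G _ _ _) sM M0).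
  by move=> d; exact: (second_derivative_linear_outer d sM M0).
move=> k u v; rewrite !BE.
have -> : (0, k *: u + v) = k *: (0, u) + (0, v) :> 'rV[R]_n * 'rV[R]_n.
  by rewrite -[RHS]/(k *: 0 + 0, k *: u + v) scaler0 addr0.
have -> : (k *: u + v, 0) = k *: (u, 0) + (v, 0) :> 'rV[R]_n * 'rV[R]_n.
  by rewrite -[RHS]/(k *: u + v, k *: 0 + 0) scaler0 addr0.
by rewrite B1 B2 scalerBr opprD addrACA.
Qed.

Lemma adE xi eta : ad G xi eta = lie_bracket G xi eta.
Proof. by apply: linfunE_of_linear; exact: lie_bracket_linear. Qed.

End ChartCalculus.

(** * Curves in the group and their left velocity *)

Section Curves.
Variables (R : realType) (n : nat) (G : lieGroupType R n) (T : R).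
Hypothesis T_gt0 : 0 < T.
Implicit Types (p q r a : G) (g : R -> G).
Local Notation phi := (chart_at (1%g : G)).
Local Notation x0 := (chart_at (1%g : G) 1%g).
Local Notation M := (chart_mul (1%g : G) 1%g 1%g).
Local Notation Mdom := (chart_mul_dom (1%g : G) 1%g 1%g).
Local Notation I := (`[0, T]%classic : set R).

Lemma clamp_near (P : R -> Prop) (t : R) :
  (\forall s \near clamp T t, I s -> P s) -> \forall s \near t, P (clamp T s).
Proof.
move=> H; have {}H := @clamp_continuous _ T t _ H.
have {}H : \forall s \near t, I (clamp T s) -> P (clamp T s) by exact: H.
by apply: filterS H => s Hs; exact: (Hs (clamp_in s T_gt0)).
Qed.

Lemma clamp_continuous_at (Y : topologicalType) (f : R -> Y) (t : R) :
  continuous_in_at I f (clamp T t) ->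
  {for t, continuous (fun s => f (clamp T s))}.
Proof.
move=> H B /= lB.
have H1 : \forall s \near clamp T t, I s -> B (f s) by exact: H.
exact: clamp_near H1.
Qed.

Lemma within_clamp_continuous (Y : topologicalType) (f : R -> Y) :
  {within I, continuous f} -> continuous (fun s => f (clamp T s)).
Proof.
move=> /subspace_continuousP cf t; apply: clamp_continuous_at.
exact: (cf _ (clamp_in t T_gt0)).
Qed.

Lemma near_within_chart g p (t : R) : continuous_in_at I g t ->
  cdom (chart_at p) (g t) -> \forall s \near t, I s -> cdom (chart_at p) (g s).
Proof.
move=> cg pt.
by exact: cg _ (open_nbhs_nbhs (conj (@cdom_open _ _ _ (chart_at p)) pt)).
Qed.

(** Left translation by a fixed element is the product with its first argument
    frozen. *)
Lemma is_derive_in_translate g a o p r (t : R) v : I t -> continuous_in_at I g t ->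
  cdom (chart_at o) a -> cdom (chart_at p) (g t) -> cdom (chart_at r) (a * g t)%g ->
  is_derive_in I (fun s => chart_at p (g s)) t v ->
  is_derive_in I (fun s => chart_at r (a * g s)%g) t
    ('d (chart_mul o p r) (chart_at o a, chart_at p (g t)) (0, v)).
Proof.
move=> It cg oa pt rt dg.
have Dm : chart_mul_dom o p r (chart_at o a, chart_at p (g t)).
  by split => /=; [exact: cmap_cod|exact: cmap_cod|rewrite !cmapK].
have dm := smooth_on_diff (@chart_mul_smooth _ _ G o p r) Dm.
have [d2 E2] := diff_slice2 dm.
rewrite -E2.
have := is_derive_in_comp It dg d2.
apply: is_derive_in_near => //.
apply: filterS (near_within_chart cg pt) => s ps Is.
by rewrite /chart_mul /= !cmapK//; exact: ps.
Qed.

Lemma is_derive_in_mul g h o p r (t : R) v w : I t ->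
  continuous_in_at I g t -> continuous_in_at I h t ->
  cdom (chart_at o) (g t) -> cdom (chart_at p) (h t) ->
  cdom (chart_at r) (g t * h t)%g ->
  is_derive_in I (fun s => chart_at o (g s)) t v ->
  is_derive_in I (fun s => chart_at p (h s)) t w ->
  is_derive_in I (fun s => chart_at r (g s * h s)%g) t
    ('d (chart_mul o p r) (chart_at o (g t), chart_at p (h t)) (v, w)).
Proof.
move=> It cg ch ot pt rt dg dh.
have Dm : chart_mul_dom o p r (chart_at o (g t), chart_at p (h t)).
  by split => /=; [exact: cmap_cod|exact: cmap_cod|rewrite !cmapK].
have dm := smooth_on_diff (@chart_mul_smooth _ _ G o p r) Dm.
have := is_derive_in_comp It (is_derive_in_pair It dg dh) dm.
apply: is_derive_in_near => //.
apply: filterS2 (near_within_chart cg ot) (near_within_chart ch pt) => s os ps Is.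
by rewrite /chart_mul /= !cmapK//; [exact: ps|exact: os].
Qed.

(** The left velocity is defined with the tangent map of a translation; by the
    chain rule it is the derivative of [g(t)^-1 g(s)] at [s = t], in the chart
    at the identity. *)
Lemma left_velocity_is_derive g (t : R) : I t -> continuous_in_at I g t ->
  derivable_in I (chart_at (g t) \o g) t ->
  is_derive_in I (fun s => phi ((g t)^-1 * g s)%g) t (left_velocity T g t).
Proof.
move=> It cg dg.
have pt : cdom (chart_at (g t)) (g t) by exact: mem_chart_at.
have rt : cdom phi ((g t)^-1 * g t)%g by rewrite mulVg; exact: mem_chart_at.
have vE := derivable_inP dg.
have := is_derive_in_translate It cg (mem_chart_at _) pt rt vE.
rewrite /left_velocity /tangent_map mulVg.
set L := ('d _ _ _); set L' := ('d _ _ _).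
suff -> : L = L' by [].
have Dm : chart_mul_dom (g t)^-1%g (g t) 1%g
    (chart_at (g t)^-1%g (g t)^-1%g, chart_at (g t) (g t)).
  split => /=; [exact: cmap_cod (mem_chart_at _)|exact: cmap_cod|].
  by rewrite !cmapK//; exact: mem_chart_at.
have dm := smooth_on_diff (@chart_mul_smooth _ _ G _ _ _) Dm.
have [d2 E2] := diff_slice2 dm.
apply: (etrans (esym (E2 _))).
have EE : (fun w => chart_mul (g t)^-1%g (g t) 1%g
      (chart_at (g t)^-1%g (g t)^-1%g, w)) =
    phi \o (fun h => (g t)^-1 * h)%g \o cinv (chart_at (g t)).
  by apply/funext => w; rewrite /chart_mul /= cmapK//; exact: mem_chart_at.
exact: (congr1 (fun F : 'rV[R]_n -> 'rV[R]_n =>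
  'd F (chart_at (g t) (g t)) (velocity T g t)) EE).
Qed.

Lemma left_velocity_unique g (t : R) v : I t -> continuous_in_at I g t ->
  derivable_in I (chart_at (g t) \o g) t ->
  is_derive_in I (fun s => phi ((g t)^-1 * g s)%g) t v ->
  left_velocity T g t = v.
Proof.
move=> It cg dg dv; apply: (is_derive_in_unique T_gt0 It _ dv).
exact: left_velocity_is_derive.
Qed.

Lemma continuous_diff_along (U W : normedModType R) (A : set U) (f : U -> W)
    (E V : R -> U) (t : R) : has_coords U -> open A -> smooth_on A f -> A (E t) ->
  {for t, continuous E} -> {for t, continuous V} ->
  {for t, continuous (fun s => 'd f (E s) (V s))}.
Proof.
move=> hU oA sf AE cE cV.
have [c _ _] := dparam_diff hU oA sf AE
  (dparam_of_continuous 0 cE) (dparam_of_continuous 0 cV).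
have c1 : {for t, continuous (fun s : R => (0 : R, s))}.
  by apply: continuous_pair; [exact: cvg_cst|exact: cvg_id].
exact: (continuous_comp c1 c).
Qed.

End Curves.

(** * Continuity of the control *)

Section ControlCurve.
Variables (R : realType) (n : nat) (G : lieGroupType R n) (T : R).
Hypothesis T_gt0 : 0 < T.
Variable g : R -> G.
Hypothesis g_C1 : C1_curve T g.
Local Notation phi := (chart_at (1%g : G)).
Local Notation x0 := (chart_at (1%g : G) 1%g).
Local Notation M := (chart_mul (1%g : G) 1%g 1%g).
Local Notation Mdom := (chart_mul_dom (1%g : G) 1%g 1%g).
Local Notation I := (`[0, T]%classic : set R).
Local Notation gc := (fun s => g (clamp T s)).

Lemma C1_curve_continuous_in (t : R) : I t -> continuous_in_at I g t.
Proof. by have [/subspace_continuousP cg _] := g_C1; exact: cg. Qed.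

Lemma C1_curve_derivable (p : G) (t : R) : I t -> cdom (chart_at p) (g t) ->
  derivable_in I (chart_at p \o g) t.
Proof. by have [_ H] := g_C1 => It pt; have [] := H p t It pt. Qed.

Lemma C1_curve_D_continuous (p : G) (t : R) : cdom (chart_at p) (gc t) ->
  {for t, continuous (fun s => D_in I (chart_at p \o g) (clamp T s))}.
Proof.
have [_ H] := g_C1 => pt; apply: (clamp_continuous_at T_gt0).
by have [] := H p _ (clamp_in t T_gt0) pt.
Qed.

Lemma curve_clamp_continuous : continuous gc.
Proof. by have [cg _] := g_C1; exact: within_clamp_continuous. Qed.

Lemma mulg_continuous_in_at (A : set R) (a b : R -> G) (t : R) :
  continuous_in_at A a t -> continuous_in_at A b t ->
  continuous_in_at A (fun s => a s * b s)%g t.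
Proof.
move=> ca cb; rewrite /continuous_in_at.
have cab : (a s, b s) @[s --> within A (nbhs t)] --> (a t, b t).
  exact: cvg_pair ca cb.
exact: (cvg_comp _ _ cab (@lie_mul_continuous _ _ G (a t, b t))).
Qed.

(** The chart used to define the velocity at [t] changes with [t].  Near [t]
    everything is read in one chart: with [k(s) = g(t)^-1 g(s)], the control
    at [s] is the derivative of [k(s)^-1 k], an expression in the fixed smooth
    maps [M] and [chart_inv], evaluated at continuous curves. *)
Lemma left_velocity_continuous :
  continuous (fun s => left_velocity T g (clamp T s)).
Proof.
move=> t; set tau := clamp T t; pose a := ((g tau)^-1)%g; pose q := g tau.
have Itau : I tau by exact: (clamp_in t T_gt0).
have qtau : cdom (chart_at q) (gc t) by exact: mem_chart_at.
have kt : (a * gc t)%g = 1%g by rewrite mulVg.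
have ck : {for t, continuous (fun s => a * gc s)%g}.
  by apply: mulg_continuous_at; [exact: cst_continuous|exact: curve_clamp_continuous].
have k0 : cdom phi (a * gc t)%g by rewrite kt; exact: mem_chart_at.
pose kap s := phi (a * gc s)%g.
have ckap : {for t, continuous kap} by exact: chart_continuous_at.
have kapt : kap t = x0 by rewrite /kap kt.
pose yq s := chart_at q (gc s).
pose vq s := D_in I (chart_at q \o g) (clamp T s).
have cyq : {for t, continuous yq}.
  by apply: chart_continuous_at => //; exact: curve_clamp_continuous.
have cvq : {for t, continuous vq} by exact: C1_curve_D_continuous.
(* [dkap] is the velocity of [k] read in the chart at the identity *)
pose E1 s : 'rV[R]_n * 'rV[R]_n := (chart_at a a, yq s).
pose V1 s : 'rV[R]_n * 'rV[R]_n := (0, vq s).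
pose dkap s : 'rV[R]_n := 'd (chart_mul a q 1%g) (E1 s) (V1 s).
have hc := prod_has_coords (rV_has_coords R n) (rV_has_coords R n).
have cst_c (c : 'rV[R]_n) : {for t, continuous (fun _ : R => c)} by exact: cst_continuous.
have E1t : chart_mul_dom a q 1%g (E1 t).
  split => /=; [exact: cmap_cod (mem_chart_at a)|exact: cmap_cod|].
  rewrite (cmapK (mem_chart_at a)) cmapK; [exact: k0|exact: mem_chart_at].
have cE1 : {for t, continuous E1} := continuous_pair (cst_c _) cyq.
have cV1 : {for t, continuous V1} := continuous_pair (cst_c _) cvq.
have cdkap : {for t, continuous dkap}.
  exact (continuous_diff_along hc (@chart_mul_dom_open _ _ G _ _ _)
    (@chart_mul_smooth _ _ G _ _ _) E1t cE1 cV1).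
(* translating [dkap s] back to the identity gives the control at [s] *)
pose E2 s : 'rV[R]_n * 'rV[R]_n := (chart_inv G (kap s), kap s).
pose V2 s : 'rV[R]_n * 'rV[R]_n := (0, dkap s).
have kinv : chart_inv_dom G (kap t) by rewrite kapt; exact: unit_inv_dom.
have civ : {for kap t, continuous (chart_inv G)}.
  exact: (smooth_on_continuous (@chart_inv_smooth _ _ G) kinv).
have cE2 : {for t, continuous E2}.
  exact (continuous_pair (continuous_comp ckap civ) ckap).
have cV2 : {for t, continuous V2} := continuous_pair (cst_c _) cdkap.
have cform : {for t, continuous (fun s => 'd M (E2 s) (V2 s))}.
  exact (continuous_diff_along hc (@chart_mul_dom_open _ _ G _ _ _)
    (@chart_mul_smooth _ _ G _ _ _) (chart_mul_dom_invl kinv) cE2 cV2).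
apply: near_eq_continuous cform.
have n1 : \forall s \near t, cdom (chart_at q) (gc s).
  by apply: chart_near_dom => //; exact: curve_clamp_continuous.
have n2 : \forall s \near t, cdom phi (a * gc s)%g by exact: chart_near_dom.
have n3 : \forall s \near t, chart_inv_dom G (kap s).
  exact: ckap _ (open_nbhs_nbhs (conj (@chart_inv_dom_open _ _ G) kinv)).
apply: filterS3 n1 n2 n3 => s qs ks ivs; set sg := clamp T s.
have Isg : I sg by exact: (clamp_in s T_gt0).
have cg := C1_curve_continuous_in Isg.
have dq : is_derive_in I (fun s => phi (a * g s)%g) sg (dkap s).
  exact (is_derive_in_translate Isg cg (mem_chart_at a) qs ks
    (derivable_inP (C1_curve_derivable Isg qs))).
have ckc : continuous_in_at I (fun s => a * g s)%g sg.
  by apply: mulg_continuous_in_at; [exact: cvg_cst|exact: cg].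
have cK : cinv phi (kap s) = (a * g sg)%g by rewrite /kap cmapK.
have iK : cdom phi ((a * g sg)^-1)%g by case: ivs; rewrite cK.
have rt : cdom phi ((a * g sg)^-1 * (a * g sg))%g by rewrite mulVg; exact: mem_chart_at.
have d2 := is_derive_in_translate Isg ckc iK ks rt dq.
apply/esym.
have dgg := C1_curve_derivable Isg (mem_chart_at (g sg)).
apply: (left_velocity_unique T_gt0 Isg cg dgg).
move: d2; rewrite /E2 /V2 /chart_inv cK /kap.
apply: (is_derive_in_eq Isg) => s' _.
by rewrite invgM -mulgA mulKg.
Qed.

End ControlCurve.

(** * Parametrised functions known on part of the plane *)

Section Transfer.
Variable R : realType.
Implicit Types V W : normedModType R.

Lemma dparam_affine W (w c : R -> W) (e t : R) :
  {for t, continuous w} -> {for t, continuous c} ->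
  dparam (fun e t => w t + e *: c t) (fun _ t => c t) e t.
Proof.
move=> cw cc.
have cw2 : {for (e, t), continuous (fun z : R * R => w z.2)}.
  by apply: (@continuous_comp _ _ _ (snd : R * R -> R) w); [exact: cvg_snd|exact: cw].
have cc2 : {for (e, t), continuous (fun z : R * R => c z.2)}.
  by apply: (@continuous_comp _ _ _ (snd : R * R -> R) c); [exact: cvg_snd|exact: cc].
split.
- by apply: cvgD; [exact: cw2|apply: cvgZ; [exact: cvg_fst|exact: cc2]].
- exact: cc2.
- apply: filterE => z /=.
  have d1 := is_derive1_scale (is_derive_id z.1 (1 : R))
    (is_derive_cst (c z.2) z.1 (1 : R)).
  have := is_deriveD (is_derive_cst (w z.2) z.1 (1 : R)) d1.
  by rewrite scale1r scaler0 addr0 add0r.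
Qed.

(** The conditions on a variation only concern times in [[0, T]], where the
    derivatives in time are the one-sided ones.  A function agreeing at those
    times with a parametrised one inherits the three properties, because the
    parameter is differentiated at a fixed time. *)
Lemma dparam_transfer W (E E' F : R -> R -> W) (D : set (R * R)) (I : set R) (e t : R) :
  I t -> (forall z, D z -> I z.2) ->
  (\forall z \near (e, t), I z.2 -> E z.1 z.2 = F z.1 z.2) ->
  dparam E E' e t ->
  [/\ derivable (F^~ t) e 1,
      continuous_in_at D (fun z => F z.1 z.2) (e, t) &
      continuous_in_at D (fun z => derive1 (F^~ z.2) z.1) (e, t)].
Proof.
move=> It DI EF [cE cE' dE].
have EFt := nbhs_singleton EF It.
have dF : \forall z \near (e, t), I z.2 -> is_derive z.1 (1 : R) (F^~ z.2) (E' z.1 z.2).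
  apply: filterS2 dE (near_join EF) => z dEz /near_slice /= EFz Iz.
  apply: near_eq_is_derive dEz; apply: filterS EFz => s; exact.
have dFt := nbhs_singleton dF It.
split; first by case: dFt.
- move=> B /=; rewrite -EFt => lB.
  have {}cE : \forall z \near (e, t), B (E z.1 z.2) by exact: cE.
  suff : \forall z \near (e, t), D z -> B (F z.1 z.2) by [].
  by apply: filterS2 cE EF => z BE EFz Dz; rewrite -(EFz (DI _ Dz)).
- move=> B /=; rewrite (is_derive_derive1 dFt) => lB.
  have {}cE' : \forall z \near (e, t), B (E' z.1 z.2) by exact: cE'.
  suff : \forall z \near (e, t), D z -> B (derive1 (F^~ z.2) z.1) by [].
  apply: filterS2 cE' dF => z BE dFz Dz.
  by rewrite (is_derive_derive1 (dFz (DI _ Dz))).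
Qed.

End Transfer.

(** * The variation by right translations *)

Section Variation.
Variables (R : realType) (n : nat) (G : lieGroupType R n) (T : R).
Hypothesis T_gt0 : 0 < T.
Variable g : R -> G.
Hypothesis g_C1 : C1_curve T g.
Local Notation phi := (chart_at (1%g : G)).
Local Notation x0 := (chart_at (1%g : G) 1%g).
Local Notation M := (chart_mul (1%g : G) 1%g 1%g).
Local Notation Mdom := (chart_mul_dom (1%g : G) 1%g 1%g).
Local Notation I := (`[0, T]%classic : set R).
Local Notation gc := (fun s => g (clamp T s)).
Variables (f f' : R -> R) (eta : 'rV[R]_n).
Hypothesis cf' : continuous f'.
Hypothesis df : forall t : R, I t -> is_derive t (1 : R) (f : R -> R^o) (f' t).

(** The coordinates of the right factor of the variation. *)
Definition var_point (e t : R) : 'rV[R]_n := x0 + e *: (f (clamp T t) *: eta).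

(** The derivative in time of [var_point]; the summand [0] gives it the shape
    of [dparam_affine]. *)
Definition var_speed (e t : R) : 'rV[R]_n := 0 + e *: (f' t *: eta).

Lemma profile_continuous : continuous (fun t => f (clamp T t)).
Proof.
move=> t; apply: (@continuous_comp _ _ _ (clamp T) f); first exact: clamp_continuous.
exact: is_derive1_continuous (df (clamp_in t T_gt0)).
Qed.

Lemma continuous_scale_cst (V : normedModType R) (k : R -> R) (v : V) (t : R) :
  {for t, continuous k} -> {for t, continuous (fun s => k s *: v)}.
Proof. by move=> ck; apply: cvgZ; [exact: ck|exact: cvg_cst]. Qed.

Lemma dparam_var_point (e t : R) :
  dparam var_point (fun _ s => f (clamp T s) *: eta) e t.
Proof.
apply: (@dparam_affine _ _ (fun _ => x0)); first exact: cst_continuous.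
by apply: continuous_scale_cst; exact: profile_continuous.
Qed.

Lemma dparam_var_speed (e t : R) :
  dparam var_speed (fun _ s => f' s *: eta) e t.
Proof.
apply: (@dparam_affine _ _ (fun _ => 0)); first exact: cst_continuous.
by apply: continuous_scale_cst; exact: cf'.
Qed.

Lemma is_derive_var_point (e t : R) : I t ->
  is_derive_in I (var_point e) t (var_speed e t).
Proof.
move=> It.
apply: (@is_derive_in_eq _ _ _ (fun s => x0 + e *: (f s *: eta))) => //.
  by move=> s Is; rewrite /var_point clampE.
apply: is_derive_is_derive_in; apply: is_deriveD; apply: is_deriveZ.
have := is_derive1_scale (df It) (is_derive_cst eta t (1 : R)).
by rewrite scaler0 addr0.
Qed.

Lemma var_point0 (t : R) : var_point 0 t = x0.
Proof. by rewrite /var_point scale0r addr0. Qed.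

Lemma var_speed0 (t : R) : var_speed 0 t = 0.
Proof. by rewrite /var_speed scale0r addr0. Qed.

(** The profile [f] is bounded on [[0, T]], so for a small parameter the
    coordinates stay in a ball around those of the identity on which the group
    inverse is defined. *)
Lemma exists_var_range : exists2 d : R, 0 < d &
  forall e t, `|e| < d -> chart_inv_dom G (var_point e t).
Proof.
have /nbhs_ballP[r /= r0 Hr] : nbhs x0 (chart_inv_dom G).
  exact: (open_nbhs_nbhs (conj (@chart_inv_dom_open _ _ G) (unit_inv_dom G))).
have cK : compact ((fun t => f (clamp T t)) @` I).
  apply: continuous_compact; last exact: segment_compact.
  by apply: continuous_subspaceT; exact: profile_continuous.
have [K [Kr HK]] := compact_bounded cK.
pose B : R := `|K| + 1.
have B0 : 0 < B by rewrite /B ltr_wpDl.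
have fB t : `|f (clamp T t)| <= B.
  apply: (HK B); first by rewrite /B (le_lt_trans (ler_norm K))// ltrDl.
  exists (clamp T t); first exact: (clamp_in t T_gt0).
  by rewrite clampE//; exact: (clamp_in t T_gt0).
pose N : R := `|eta| + 1; have N0 : 0 < N by rewrite /N ltr_wpDl.
(* [B] bounds the profile and [N] the direction *)
exists (r / (B * N)); first by rewrite divr_gt0// mulr_gt0.
move=> e t ed; apply: Hr; rewrite -ball_normE /ball_ /= /var_point.
rewrite opprD addrA subrr add0r normrN.
rewrite !normrZ.
apply: (@le_lt_trans _ _ (`|e| * (B * N))); last by rewrite -ltr_pdivlMr// mulr_gt0.
apply: ler_wpM2l => //; apply: ler_pM => //.
by rewrite /N lerDl.
Qed.

Variable d : R.
Hypothesis d_gt0 : 0 < d.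
Hypothesis d_range : forall e t, `|e| < d -> chart_inv_dom G (var_point e t).

Lemma var_point_cod e t : `|e| < d -> ccod phi (var_point e t).
Proof. by move=> /(d_range t)[]. Qed.

Definition var_factor (e t : R) : G := cinv phi (var_point e t).

Definition variation (e t : R) : G := (gc t * var_factor e t)%g.

Lemma var_factor_continuous e t : `|e| < d ->
  {for (e, t), continuous (uncurry2 var_point)} ->
  {for (e, t), continuous (fun z : R * R => var_factor z.1 z.2)}.
Proof.
move=> ed cz.
have cc : {for uncurry2 var_point (e, t), continuous (cinv phi)}.
  by apply: cinv_continuous; exact: var_point_cod.
exact (continuous_comp cz cc).
Qed.

Lemma var_factor_continuous_in e t : I t -> `|e| < d ->
  continuous_in_at I (var_factor e) t.
Proof.
move=> It ed; have c := is_derive_in_continuous It (@is_derive_var_point e _ It).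
have cc : {for var_point e t, continuous (cinv phi)}.
  by apply: cinv_continuous; exact: var_point_cod.
exact: (cvg_comp _ _ c cc).
Qed.

Lemma curve_clamp_continuous_in t : I t -> continuous_in_at I gc t.
Proof.
move=> It; apply: cvg_within_filter; exact: (curve_clamp_continuous T_gt0 g_C1).
Qed.

Lemma variation_continuous_in e t : I t -> `|e| < d ->
  continuous_in_at I (variation e) t.
Proof.
move=> It ed; apply: mulg_continuous_in_at; first exact: curve_clamp_continuous_in.
exact: var_factor_continuous_in.
Qed.

Lemma phi_var_factor e t : `|e| < d -> phi (var_factor e t) = var_point e t.
Proof. by move=> ed; rewrite /var_factor cinvK//; exact: var_point_cod. Qed.

Lemma is_derive_var_factor e t : I t -> `|e| < d ->
  is_derive_in I (fun s => phi (var_factor e s)) t (var_speed e t).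
Proof.
move=> It ed; apply: (is_derive_in_eq It) (@is_derive_var_point e _ It) => s _.
by rewrite phi_var_factor.
Qed.

Lemma is_derive_curve_clamp q t : I t -> cdom (chart_at q) (gc t) ->
  is_derive_in I (fun s => chart_at q (gc s)) t (D_in I (chart_at q \o g) (clamp T t)).
Proof.
move=> It; have ct : clamp T t = t by exact: clampE.
rewrite ct => qt.
apply: (is_derive_in_eq It) (derivable_inP (C1_curve_derivable g_C1 It qt)) => s Is.
by rewrite /= clampE.
Qed.

Definition var_pos (q : G) (e t : R) := (chart_at q (gc t), var_point e t).
Definition var_vel (q : G) (e t : R) :=
  (D_in I (chart_at q \o g) (clamp T t), var_speed e t).

(** As a function of [(e, t)] the right-hand side falls under [dparam_diff],
    which is how the conditions on a variation are verified. *)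
Lemma is_derive_variation p q e t : I t -> `|e| < d ->
  cdom (chart_at q) (gc t) -> cdom (chart_at p) (variation e t) ->
  is_derive_in I (fun s => chart_at p (variation e s)) t
    ('d (chart_mul q 1%g p) (var_pos q e t) (var_vel q e t)).
Proof.
move=> It ed qt pt.
have h1 : cdom phi (var_factor e t) by apply: cinv_dom; exact: var_point_cod.
have := is_derive_in_mul It (curve_clamp_continuous_in It)
  (var_factor_continuous_in It ed) qt h1 pt (is_derive_curve_clamp It qt)
  (is_derive_var_factor It ed).
by rewrite phi_var_factor.
Qed.

Lemma var_pos_dom p q e t : `|e| < d ->
  cdom (chart_at q) (gc t) -> cdom (chart_at p) (variation e t) ->
  chart_mul_dom q 1%g p (var_pos q e t).
Proof.
move=> ed qt pt; split => /=; [exact: cmap_cod|exact: var_point_cod|].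
by rewrite cmapK.
Qed.

Lemma chart_variation p q e t : cdom (chart_at q) (gc t) ->
  chart_mul q 1%g p (var_pos q e t) = chart_at p (variation e t).
Proof. by move=> qt; rewrite /chart_mul /= cmapK. Qed.

Lemma dparam_var_pos q e t : cdom (chart_at q) (gc t) ->
  dparam (var_pos q) (fun _ s => (0, f (clamp T s) *: eta)) e t.
Proof.
move=> qt; apply: dparam_pair; last exact: dparam_var_point.
apply: dparam_of_continuous; apply: chart_continuous_at => //.
exact: (curve_clamp_continuous T_gt0 g_C1).
Qed.

Lemma dparam_var_vel q e t : cdom (chart_at q) (gc t) ->
  dparam (var_vel q) (fun _ s => (0, f' s *: eta)) e t.
Proof.
move=> qt; apply: dparam_pair; last exact: dparam_var_speed.
by apply: dparam_of_continuous; exact: (C1_curve_D_continuous T_gt0 g_C1 qt).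
Qed.

Lemma near_small (e t : R) : `|e| < d -> \forall z \near (e, t), `|z.1| < d.
Proof.
move=> ed.
have c : {for (e, t), continuous (fun z : R * R => `|z.1|)}.
  apply: (@continuous_comp _ _ _ (fst : R * R -> R) (fun x : R => `|x|)).
    exact: cvg_fst.
  exact: norm_continuous.
have o : open [set x : R | x < d] by exact: open_lt.
exact: c _ (open_nbhs_nbhs (conj o ed)).
Qed.

Lemma variation_continuous e t : `|e| < d ->
  {for (e, t), continuous (fun z : R * R => variation z.1 z.2)}.
Proof.
move=> ed; apply: mulg_continuous_at.
  apply: (@continuous_comp _ _ _ (snd : R * R -> R) gc); first exact: cvg_snd.
  exact: (curve_clamp_continuous T_gt0 g_C1).
by have [c _ _] := dparam_var_point e t; exact (var_factor_continuous ed c).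
Qed.

Lemma near_variation_chart p e t : `|e| < d -> cdom (chart_at p) (variation e t) ->
  \forall z \near (e, t), cdom (chart_at p) (variation z.1 z.2).
Proof.
move=> ed pt.
exact: (chart_near_dom (a := fun z : R * R => variation z.1 z.2)
  (variation_continuous ed) pt).
Qed.

Lemma near_curve_chart q (e t : R) : cdom (chart_at q) (gc t) ->
  \forall z \near (e, t), cdom (chart_at q) (gc z.2).
Proof.
move=> qt.
have c : {for (e, t), continuous (fun z : R * R => gc z.2)}.
  apply: (@continuous_comp _ _ _ (snd : R * R -> R) gc); first exact: cvg_snd.
  exact: (curve_clamp_continuous T_gt0 g_C1).
exact: (chart_near_dom (a := fun z : R * R => gc z.2) c qt).
Qed.

Local Notation ug := (fun s => left_velocity T g (clamp T s)).

(** The velocity at [s = t] of [g(t)^-1 g(s) h(s)], where [h] is [var_factor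
    e], in the chart at the identity. *)
Definition var_inner (e t : R) : 'rV[R]_n :=
  'd M (x0, var_point e t) (ug t, var_speed e t).

(** The vector [var_inner e t], based at [var_factor e t], translated back to
    the identity by the inverse of that factor. *)
Definition var_control (e t : R) : 'rV[R]_n :=
  'd M (chart_inv G (var_point e t), var_point e t) (0, var_inner e t).

(** With [Gam] for [variation e] and [h] for [var_factor e], the curve
    [Gam(t)^-1 Gam(s)] equals [h(t)^-1 (g(t)^-1 g(s) h(s))], whose derivative
    is obtained by one product rule and one translation. *)
Lemma left_velocity_variation (e t : R) : I t -> `|e| < d ->
  left_velocity T (variation e) t = var_control e t.
Proof.
move=> It ed.
have ir := d_range t ed; have cr := var_point_cod t ed.
have cv := variation_continuous_in It ed.
have gt : gc t = g t by rewrite clampE.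
have qt : cdom (chart_at (gc t)) (gc t) by exact: mem_chart_at.
have dv : derivable_in I (chart_at (variation e t) \o variation e) t.
  have pt : cdom (chart_at (variation e t)) (variation e t) by exact: mem_chart_at.
  exact: is_derive_in_derivable (is_derive_variation It ed qt pt).
apply: (left_velocity_unique T_gt0 It cv dv).
pose k s := ((gc t)^-1 * gc s)%g.
have ck : continuous_in_at I k t.
  by apply: mulg_continuous_in_at; [exact: cvg_cst|exact: curve_clamp_continuous_in].
have k1 : k t = 1%g by rewrite /k mulVg.
have kd : cdom phi (k t) by rewrite k1; exact: mem_chart_at.
have dk : is_derive_in I (fun s => phi (k s)) t (ug t).
  have dg := C1_curve_derivable g_C1 It (mem_chart_at (g t)).
  have cg := C1_curve_continuous_in g_C1 It.
  have H := left_velocity_is_derive It cg dg.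
  rewrite [clamp T t]clampE//.
  by apply: (is_derive_in_eq It) H => s Is; rewrite /k gt clampE.
have hd : cdom phi (var_factor e t) by exact: cinv_dom.
have khd : cdom phi (k t * var_factor e t)%g by rewrite k1 mul1g.
have ch := var_factor_continuous_in It ed.
have d1 := is_derive_in_mul It ck ch kd hd khd dk (is_derive_var_factor It ed).
have ckh : continuous_in_at I (fun s => k s * var_factor e s)%g t.
  by apply: mulg_continuous_in_at; [exact: ck|exact: ch].
have hid : cdom phi (var_factor e t)^-1%g by case: ir.
have r1 : cdom phi ((var_factor e t)^-1 * (k t * var_factor e t))%g.
  by rewrite k1 mul1g mulVg; exact: mem_chart_at.
have d2 := is_derive_in_translate It ckh hid khd r1 d1.
(* the base points simplify because [k t] is the identity *)
have EL : 'd M (phi (var_factor e t)^-1%g, phi (k t * var_factor e t)%g)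
   (0, 'd M (phi (k t), phi (var_factor e t)) (ug t, var_speed e t)) = var_control e t.
  have E1 : phi (var_factor e t)^-1%g = chart_inv G (var_point e t) by [].
  have E2 : phi (k t * var_factor e t)%g = var_point e t.
    by rewrite k1 mul1g phi_var_factor.
  have E3 : phi (k t) = x0 by rewrite k1.
  have E4 : phi (var_factor e t) = var_point e t by rewrite phi_var_factor.
  by rewrite E1 E2 E3 E4.
rewrite -EL.
apply: (is_derive_in_eq It) d2 => s _.
by rewrite /variation invgM /k !mulgA.
Qed.

(** Left translation by [var_factor e t] removes the inverse.  This relation,
    unlike the definition of [var_control], can be differentiated at [e = 0]
    with only the second derivatives of [M] that appear in the bracket. *)
Lemma var_control_relation (e t : R) : `|e| < d ->
  'd M (var_point e t, x0) (0, var_control e t) = var_inner e t.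
Proof. by move=> ed; exact: (diff_chart_mul_invl _ (d_range t ed)). Qed.

Lemma dparam_cst (W : normedModType R) (w : W) (e t : R) :
  dparam (fun _ _ => w) (fun _ _ => 0) e t.
Proof. by apply: (@dparam_of_continuous _ _ (fun _ => w)); exact: cst_continuous. Qed.

Local Notation fc := (fun s => f (clamp T s)).

Lemma dparam_var_inner (e t : R) : `|e| < d ->
  dparam var_inner
    (fun e t => 'D_(0, fc t *: eta) ('D_(ug t, var_speed e t) M) (x0, var_point e t) +
                'd M (x0, var_point e t) (0, f' t *: eta)) e t.
Proof.
move=> ed; have cr := var_point_cod t ed.
have hc := prod_has_coords (rV_has_coords R n) (rV_has_coords R n).
have dP := dparam_pair (dparam_cst x0 e t) (dparam_var_point e t).
have cug : {for t, continuous ug}.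
  exact: (left_velocity_continuous T_gt0 g_C1).
have dV := dparam_pair (dparam_of_continuous e cug) (dparam_var_speed e t).
exact (dparam_diff hc (@chart_mul_dom_open _ _ G _ _ _)
  (@chart_mul_smooth _ _ G _ _ _) (chart_mul_dom_1l cr) dP dV).
Qed.

Lemma dparam_var_control_ex : exists U', forall e t : R, `|e| < d ->
  dparam var_control U' e t.
Proof.
have hc := prod_has_coords (rV_has_coords R n) (rV_has_coords R n).
eexists => e t ed; have ir := d_range t ed.
have dz := dparam_var_point e t.
have di := dparam_comp (rV_has_coords R n) (@chart_inv_dom_open _ _ G)
  (@chart_inv_smooth _ _ G) ir dz.
have dP := dparam_pair di dz.
have dV := dparam_pair (dparam_cst (0 : 'rV[R]_n) e t) (dparam_var_inner t ed).
exact (dparam_diff hc (@chart_mul_dom_open _ _ G _ _ _)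
  (@chart_mul_smooth _ _ G _ _ _) (chart_mul_dom_invl ir) dP dV).
Qed.

Lemma diff_chart_mul_11 (v w : 'rV[R]_n) : 'd M (x0, x0) (v, w) = v + w.
Proof.
have c0 := unit_cod G.
have -> : (v, w) = (v, 0) + (0, w) :> 'rV[R]_n * 'rV[R]_n.
  by rewrite -[RHS]/(v + 0, 0 + w) addr0 add0r.
have -> : 'd M (x0, x0) ((v, 0) + (0, w)) = 'd M (x0, x0) (v, 0) + 'd M (x0, x0) (0, w).
  exact: linearD.
by rewrite (diff_chart_mul_1l _ c0) (diff_chart_mul_1r _ c0).
Qed.

Lemma zero_small : `|0 : R| < d. Proof. by rewrite normr0. Qed.

Lemma var_control0 (t : R) : var_control 0 t = ug t.
Proof.
have H := var_control_relation t zero_small.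
move: H; rewrite /var_inner var_point0 var_speed0.
by rewrite !diff_chart_mul_11 add0r addr0.
Qed.

(** Differentiate [var_control_relation] at [e = 0].  The derivative sought
    appears once with coefficient the identity, and the two remaining terms
    are mixed second derivatives of [M]; after exchanging the order of
    differentiation in one of them they form the bracket of the control with
    [f eta]. *)
Lemma var_control_derive0 (U' : R -> R -> 'rV[R]_n) (t : R) :
  dparam var_control U' 0 t ->
  U' 0 t = f' t *: eta + fc t *: lie_bracket G (ug t) eta.
Proof.
move=> dU.
have hc := prod_has_coords (rV_has_coords R n) (rV_has_coords R n).
have ed := zero_small; have cr := var_point_cod t ed.
have dP := dparam_pair (dparam_var_point 0 t) (dparam_cst x0 0 t).
have dV := dparam_pair (dparam_cst (0 : 'rV[R]_n) 0 t) dU.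
have dL := dparam_diff hc (@chart_mul_dom_open _ _ G _ _ _)
  (@chart_mul_smooth _ _ G _ _ _) (chart_mul_dom_1r cr) dP dV.
have d1 := dparam_is_derive dL.
have d2 := dparam_is_derive (dparam_var_inner t ed).
have nE : \forall e \near (0 : R), 
    'd M (var_point e t, x0) (0, var_control e t) = var_inner e t.
  have := near_slice (near_small t ed).
  by apply: filterS => e /= ed'; exact: var_control_relation.
have d3 := near_eq_is_derive nE d1.
pose A : 'rV[R]_n := 'D_(fc t *: eta, 0) ('D_(0, ug t) M) (x0, x0).
pose B : 'rV[R]_n := 'D_(0, fc t *: eta) ('D_(ug t, 0) M) (x0, x0).
have E : A + U' 0 t = B + f' t *: eta.
  have := is_derive1_unique d3 d2.
  by rewrite var_control0 var_point0 var_speed0 !diff_chart_mul_11 !add0r.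
(* this exchange turns the difference [B - A] into a bracket *)
have S : B = 'D_(ug t, 0) ('D_(0, fc t *: eta) M) (x0, x0).
  exact (schwarz _ _ (@chart_mul_dom_open _ _ G _ _ _) (chart_mul_dom_1l (unit_cod G))
    (@chart_mul_smooth _ _ G _ _ _)).
have L : lie_bracket G (ug t) (fc t *: eta) = B - A.
  by rewrite S; exact: lie_bracketE.
have L2 : lie_bracket G (ug t) (fc t *: eta) = fc t *: lie_bracket G (ug t) eta.
  exact: (GRing.scalable_linear (@lie_bracket_linear _ _ G (ug t))).
rewrite -L2 L; clear -E; move: (U' 0 t) A B E => u1 A B E.
by rewrite addrA [_ + B]addrC -E [A + _]addrC addrK.
Qed.

Hypothesis f_0 : f 0 = 0.
Hypothesis f_T : f T = 0.

(** Near any [(e, t)] the variation and its velocity are, in a chart, [F(E)]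
    and ['d F (E) (V)] for a smooth [F] and parametrised [E] and [V]. *)
Lemma variation_is_variation : is_variation T g d variation.
Proof.
have var_eq t s : I s -> t = 0 -> variation t s = g s.
  by move=> Is ->; rewrite /variation /var_factor var_point0 cinv_x0 mulg1 clampE.
have I0 : I 0 by rewrite /= in_itv /= lexx ltW.
have IT : I T by rewrite /= in_itv /= lexx ltW.
have endE e s : I s -> f s = 0 -> variation e s = g s.
  move=> Is fs; rewrite /variation /var_factor /var_point (clampE Is) fs.
  by rewrite scale0r scaler0 addr0 cinv_x0 mulg1.
split.
- exact: d_gt0.
- by move=> t It; exact: var_eq.
- by move=> e ed; split; exact: endE.
- apply: continuous_in_subspaceT => -[e t]; rewrite inE => -[/= ed _].
  exact: (variation_continuous ed).
- move=> p e t D y dt_y [/= ed It] pt.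
  pose q := gc t; have qt : cdom (chart_at q) (gc t) by exact: mem_chart_at.
  have hc := prod_has_coords (rV_has_coords R n) (rV_has_coords R n).
  have Dom := var_pos_dom ed qt pt.
  have oF := @chart_mul_dom_open _ _ G q 1%g p.
  have sF := @chart_mul_smooth _ _ G q 1%g p.
  have dP := dparam_var_pos e qt; have dV := dparam_var_vel e qt.
  have nq := near_curve_chart e qt.
  have np := near_variation_chart ed pt.
  have nd := near_small t ed.
  have dY := dparam_comp hc oF sF Dom dP.
  have dDT := dparam_diff hc oF sF Dom dP dV.
  have DI z : D z -> I z.2 by case.
  have nY : \forall z \near (e, t), I z.2 ->
      chart_mul q 1%g p (var_pos q z.1 z.2) = y z.1 z.2.
    by apply: filterS nq => z qz _; exact: chart_variation.
  have nDT : \forall z \near (e, t), I z.2 ->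
      'd (chart_mul q 1%g p) (var_pos q z.1 z.2) (var_vel q z.1 z.2) =
      dt_y z.1 z.2.
    apply: filterS3 nq np nd => z qz pz dz Iz; apply/esym.
    exact: (is_derive_in_D_in T_gt0 Iz (is_derive_variation Iz dz qz pz)).
  have [d1 c1 c1'] := dparam_transfer It DI nY dY.
  have [d2 c2 c2'] := dparam_transfer It DI nDT dDT.
  split; split.
  + exact: is_derive_in_derivable (is_derive_variation It ed qt pt).
  + exact: d1.
  + exact: d2.
  + exact: c2.
  + exact: c1'.
  + exact: c2'.
Qed.

End Variation.

(** * Finite-dimensional coordinates *)

Section Coordinates.
Variable R : realType.
Implicit Types V W : normedModType R.

Lemma rV_sum_coords k (F : 'rV[R]_k) : F = \sum_i F 0 i *: delta_mx 0 i.
Proof. exact: row_sum_delta. Qed.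

Lemma sum_continuous (T : topologicalType) W k (h : 'I_k -> T -> W) t :
  (forall i, {for t, continuous (h i)}) ->
  {for t, continuous (fun s => \sum_i h i s)}.
Proof.
move=> H; have -> : (fun s => \sum_i h i s) = \sum_i h i.
  by apply/funext => s; rewrite fct_sumE.
apply: (big_ind (fun f : T -> W => {for t, continuous f})).
- exact: cvg_cst.
- by move=> f g; exact: cvgD.
- by move=> i _; exact: H.
Qed.

Lemma rV_differentiable V k (F : V -> 'rV[R]_k) x :
  (forall i, differentiable (fun y => F y 0 i : R^o) x) -> differentiable F x.
Proof.
move=> H; have -> : F = \sum_i (fun y => F y 0 i *: delta_mx 0 i).
  by apply/funext => s; rewrite fct_sumE; exact: rV_sum_coords.
by apply: differentiable_sum => i; apply: differentiableZl; exact: H.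
Qed.

(** In finite dimension a linear map is a finite sum of coordinates times
    fixed vectors. *)
Lemma linear_rV_continuous W k (L : {linear 'rV[R]_k -> W}) : continuous L.
Proof.
have -> : (L : 'rV[R]_k -> W) = fun v => \sum_i v 0 i *: L (delta_mx 0 i).
  apply/funext => v; rewrite {1}(rV_sum_coords v) linear_sum.
  by apply: eq_bigr => i _; rewrite linearZ.
move=> v; have c i : {for v, continuous (fun w : 'rV[R]_k => w 0 i *: L (delta_mx 0 i))}.
  have ci := @coord_continuous R 1 k 0 i v.
  exact (cvgZ ci (cvg_cst _)).
exact (sum_continuous c).
Qed.

End Coordinates.

Section Basis.
Variables (R : realType) (X : vectType R).
Local Notation k := (\dim {:X}).
Local Notation b := (vbasis {:X}).
Local Notation rVof := (passmx.rVof b).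
Local Notation vecof := (passmx.vecof b).

Lemma rVofvK : cancel rVof vecof.
Proof. by apply: passmx.rVofK; exact: vbasisP. Qed.

(** The functionals used in [grad_dual]. *)
Definition dual_basis (i : 'I_k) : dual X := linfun (fun x => coord b i x : R^o).

Lemma dual_basisE i x : dual_basis i x = coord b i x.
Proof. by apply: linfunE_of_linear => c u v; rewrite linearP. Qed.

Lemma dual_sum (a : dual X) : a = \sum_(i < k) (a b`_i : R) *: dual_basis i.
Proof.
apply/lfunP => x; rewrite sum_lfunE {1}(coord_vbasis (memvf x)) linear_sum.
apply: eq_bigr => i _; rewrite linearZ scale_lfunE dual_basisE.
exact: mulrC.
Qed.

End Basis.

(** * Smooth functions on the product with a vector space *)

Section SmoothFun2.
Variables (R : realType) (n : nat) (G : lieGroupType R n) (W : vectType R).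
Variable f : G -> W -> R.
Hypothesis f_smooth : smooth_fun2 f.
Local Notation phi := (chart_at (1%g : G)).
Local Notation x0 := (chart_at (1%g : G) 1%g).
Local Notation rVof := (passmx.rVof (vbasis {:W})).
Local Notation vecof := (passmx.vecof (vbasis {:W})).

(** [f] in the chart at the identity and in the basis of [W] used by
    [smooth_fun2]. *)
Definition local_fun2 (z : 'rV[R]_n * 'rV[R]_(\dim {:W})) : R^o :=
  f (cinv phi z.1) (vecof z.2).

Definition local_dom2 : set ('rV[R]_n * 'rV[R]_(\dim {:W})) :=
  [set z | ccod phi z.1].

Lemma local_fun2_smooth : smooth_on local_dom2 local_fun2.
Proof. exact: f_smooth. Qed.

Lemma local_dom2_open : open local_dom2.
Proof.
apply: open_near => -[y w] /= cy.
have c1 : {for (y, w), continuous (fst : 'rV[R]_n * 'rV[R]_(\dim {:W}) -> _)}.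
  exact: cvg_fst.
exact: c1 _ (open_nbhs_nbhs (conj (@ccod_open _ _ _ phi) cy)).
Qed.

Lemma local_dom2_unit w : local_dom2 (x0, w).
Proof. exact: unit_cod. Qed.

Lemma local_fun2E h w : cdom phi h -> local_fun2 (phi h, rVof w) = f h w.
Proof. by move=> hd; rewrite /local_fun2 /= cmapK// rVofvK. Qed.

(** [dirD] differentiates along a line in [W]; in coordinates this line is a
    direction of the second factor. *)
Lemma dirDE (a v : W) :
  dirD (f 1%g) a v = 'd local_fun2 (x0, rVof a) (0, rVof v).
Proof.
rewrite /dirD.
have d := smooth_on_diff local_fun2_smooth (local_dom2_unit (rVof a)).
have -> : (fun s : R => f 1%g (a + s *: v) : R^o) =
    fun s => local_fun2 ((x0, rVof a) + s *: (0, rVof v)).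
  apply/funext => s.
  have -> : (x0, rVof a) + s *: (0, rVof v) = (x0, rVof (a + s *: v)).
    rewrite -[LHS]/(x0 + s *: 0, rVof a + s *: rVof v) scaler0 addr0.
    by rewrite [a + _]addrC passmx.rVof_linear addrC.
  by rewrite local_fun2E//; exact: mem_chart_at.
have d' : derivable local_fun2 ((x0, rVof a) + 0 *: (0, rVof v)) (0, rVof v).
  by rewrite scale0r addr0; exact: diff_derivable.
rewrite (is_derive_derive1 (is_derive1_dir d')).
by rewrite scale0r addr0 deriveE.
Qed.

Lemma dirD_linear (a : W) : linear (dirD (f 1%g) a : W -> R^o).
Proof.
move=> c v w; rewrite !dirDE.
have -> : (0, rVof (c *: v + w)) = c *: (0, rVof v) + (0, rVof w)
    :> 'rV[R]_n * 'rV[R]_(\dim {:W}).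
  by rewrite -[RHS]/(c *: 0 + 0, c *: rVof v + rVof w) scaler0 addr0 passmx.rVof_linear.
exact: linearP.
Qed.

End SmoothFun2.

Lemma diff_linear_comb (R : realType) (V W : normedModType R) (f g : V -> W)
    (x : V) (c : R) (v : V) : differentiable f x -> differentiable g x ->
  'd (c \*: f + g) x v = c *: 'd f x v + 'd g x v.
Proof.
move=> df dg; rewrite (diffD (differentiableZ c df) dg).
by rewrite -[LHS]/('d (c \*: f) x v + 'd g x v) (diffZ c df).
Qed.

(** * The derived representation and the advected parameter *)

Section Representation.
Variables (R : realType) (n : nat) (G : lieGroupType R n).
Variables (X : vectType R) (rho : G -> 'End(X)).
Hypothesis rho_rep : smooth_representation rho.
Local Notation phi := (chart_at (1%g : G)).
Local Notation x0 := (chart_at (1%g : G) 1%g).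
Local Notation k := (\dim {:X}).
Local Notation b := (vbasis {:X}).
Local Notation rVof := (passmx.rVof b).
Local Notation vecof := (passmx.vecof b).

Lemma rho1 : rho 1%g = \1%VF. Proof. by case: rho_rep. Qed.

Lemma rhoM g h x : rho (g * h)%g x = rho g (rho h x).
Proof. by case: rho_rep => _ -> _; rewrite comp_lfunE. Qed.

(** A matrix coefficient of the representation, in the chart at the identity.
    *)
Definition coef (x : X) (a : dual X) (y : 'rV[R]_n) : R^o := a (rho (cinv phi y) x).

Lemma coef_smooth x a : smooth_on (ccod phi) (coef x a).
Proof. by case: rho_rep => _ _ H; exact: (H x a 1%g). Qed.

Lemma coef_diff x a : differentiable (coef x a) x0.
Proof. exact: smooth_on_diff (coef_smooth x a) (unit_cod G). Qed.

Lemma matrix_coef_continuous x (a : dual X) : continuous (fun h : G => a (rho h x) : R^o).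
Proof.
move=> h; pose F (y : 'rV[R]_n) : R^o := a (rho (cinv (chart_at h) y) x).
have hd := mem_chart_at h.
have sF : smooth_on (ccod (chart_at h)) F.
  by case: rho_rep => _ _ H; exact: (H x a h).
have cF : {for chart_at h h, continuous F}.
  exact: (smooth_on_continuous sF (cmap_cod hd)).
have cc : {for h, continuous (chart_at h)} by exact: cmap_continuous.
have nE : \forall h' \near h, F (chart_at h h') = a (rho h' x).
  have := open_nbhs_nbhs (conj (@cdom_open _ _ _ (chart_at h)) hd).
  by apply: filterS => h' h'd; rewrite /F cmapK.
exact (near_eq_continuous nE (continuous_comp cc cF)).
Qed.

Definition rho_vec (x : X) (y : 'rV[R]_n) : 'rV[R]_k := rVof (rho (cinv phi y) x).

Lemma rho_vec_diff x : differentiable (rho_vec x) x0.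
Proof.
apply: rV_differentiable => i.
have -> : (fun y => rho_vec x y 0 i : R^o) = coef x (dual_basis i).
  by apply/funext => y; rewrite /rho_vec mxE /coef dual_basisE.
exact: coef_diff.
Qed.

Lemma rho_vec_linear (c : R) (x y : X) :
  rho_vec (c *: x + y) = c \*: rho_vec x + rho_vec y.
Proof.
apply/funext => z; rewrite /rho_vec linearP.
by rewrite passmx.rVof_linear.
Qed.

Lemma drho_fun_linear xi : linear (fun x => vecof ('d (rho_vec x) x0 xi)).
Proof.
move=> c x y; rewrite (rho_vec_linear c x y).
have dx := rho_vec_diff x; have dy := rho_vec_diff y.
apply: (etrans (congr1 vecof (diff_linear_comb c xi dx dy))).
exact: passmx.vecof_linear.
Qed.

Lemma drho_vec xi x : drho rho xi x = vecof ('d (rho_vec x) x0 xi).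
Proof. exact: (linfunE_of_linear _ (drho_fun_linear xi)). Qed.

(** Applying a functional commutes with differentiating the vector-valued map
    behind [drho]. *)
Lemma drhoE (a : dual X) xi x : a (drho rho xi x) = 'd (coef x a) x0 xi.
Proof.
rewrite drho_vec.
have lin : linear (fun v : 'rV[R]_k => a (vecof v) : R^o).
  by move=> c u v; rewrite passmx.vecof_linear linearP.
pose L : {linear 'rV[R]_k -> R^o} :=
  HB.pack (fun v : 'rV[R]_k => a (vecof v) : R^o) (GRing.isLinear.Build _ _ _ _ _ lin).
have cL := linear_rV_continuous (L := L).
have dL := linear_differentiable (rho_vec x x0) cL.
have E := diff_comp (rho_vec_diff x) dL.
have E2 : L \o rho_vec x = coef x a.
  by apply/funext => y; rewrite /= /rho_vec rVofvK.
rewrite E2 diff_lin // in E.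
by rewrite E.
Qed.

Lemma momentumE (x : X) (a : dual X) xi : momentum rho x a xi = a (drho rho xi x).
Proof.
apply: linfunE_of_linear => c u v; rewrite !drhoE.
exact: linearP.
Qed.

Lemma adjointE (A : 'End(X)) (a : dual X) x : adjoint A a x = a (A x).
Proof. by rewrite /adjoint comp_lfunE. Qed.

Section Transport.
Variables (T : R) (g : R -> G) (alpha0 : dual X).
Hypothesis g_C1 : C1_curve T g.
Local Notation I := (`[0, T]%classic : set R).

(** Factor [rho (g s)] as [rho (g t)] followed by [rho] of [g(t)^-1 g(s)]: the
    derivative of the second factor at [s = t] is [drho] of the left velocity.
    *)
Lemma advected_is_derive (t : R) : I t ->
  dual_is_derive_in I (fun s => adjoint (rho (g s)) alpha0) t
    (adjoint (drho rho (left_velocity T g t)) (adjoint (rho (g t)) alpha0)).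
Proof.
move=> It x.
have dg := C1_curve_derivable g_C1 It (mem_chart_at (g t)).
have cg := C1_curve_continuous_in g_C1 It.
have H := left_velocity_is_derive It cg dg.
set a := adjoint (rho (g t)) alpha0.
rewrite adjointE drhoE.
have E0 : phi ((g t)^-1 * g t)%g = x0 by rewrite mulVg.
have dc : differentiable (coef x a) (phi ((g t)^-1 * g t)%g).
  by rewrite E0; exact: coef_diff.
have := is_derive_in_comp It H dc.
rewrite E0; apply: (is_derive_in_near It).
have cr : continuous_in_at I (fun s => (g t)^-1 * g s)%g t.
  by apply: mulg_continuous_in_at; [exact: cvg_cst|exact: cg].
have rd : cdom phi ((g t)^-1 * g t)%g by rewrite mulVg; exact: mem_chart_at.
apply: filterS (near_within_chart cr rd) => s sd Is.
by rewrite /coef cmapK; [rewrite /a !adjointE -rhoM mulVKg|exact: sd].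
Qed.

End Transport.
End Representation.

(** * The derivative of the potential *)

Section Potential.
Variables (R : realType) (n : nat) (G : lieGroupType R n).
Variables (X : vectType R) (rho : G -> 'End(X)).
Hypothesis rho_rep : smooth_representation rho.
Variable Vext : G -> dual X -> R.
Hypothesis Vext_smooth : smooth_fun2 Vext.
Hypothesis Vext_inv : forall (g h : G) (a : dual X),
  Vext (g * h)%g (adjoint (rho g^-1%g) a) = Vext h a.
Local Notation phi := (chart_at (1%g : G)).
Local Notation x0 := (chart_at (1%g : G) 1%g).
Local Notation b := (vbasis {:X}).
Local Notation rVofd := (passmx.rVof (vbasis {:dual X})).
Local Notation VF := (local_fun2 Vext).

(** The invariance axiom for the inverse of [h]. *)
Lemma Vext_transport (h : G) (a : dual X) :
  Vext 1%g (adjoint (rho h) a) = Vext h a.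
Proof. by have := Vext_inv h^-1%g h a; rewrite mulVg invgK. Qed.

Lemma linear_combination (V W : vectType R) (F : V -> W) (k : nat) (c : 'I_k -> R)
    (v : 'I_k -> V) : linear F -> F (\sum_i c i *: v i) = \sum_i c i *: F (v i).
Proof.
move=> lF; rewrite -(linfunE_of_linear _ lF) linear_sum; apply: eq_bigr => i _.
by rewrite linearZ /= linfunE_of_linear.
Qed.

Lemma rVofd_linear : linear rVofd. Proof. exact: passmx.rVof_linear. Qed.

Lemma adjoint_sum (A : 'End(X)) (a : dual X) :
  adjoint A a = \sum_(i < \dim {:X}) (a (A b`_i) : R) *: dual_basis i.
Proof. by rewrite [LHS]dual_sum; apply: eq_bigr => i _; rewrite adjointE. Qed.

Lemma is_derive_adjoint (a : dual X) (xi : 'rV[R]_n) :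
  is_derive (0 : R) (1 : R)
    (fun s => rVofd (adjoint (rho (cinv phi (x0 + s *: xi))) a))
    (rVofd (adjoint (drho rho xi) a)).
Proof.
have -> : rVofd (adjoint (drho rho xi) a) =
    \sum_(i < \dim {:X}) ('d (coef rho b`_i a) x0 xi : R) *: rVofd (dual_basis i).
  rewrite adjoint_sum (linear_combination _ _ rVofd_linear).
  by apply: eq_bigr => i _; rewrite drhoE.
have -> : (fun s : R => rVofd (adjoint (rho (cinv phi (x0 + s *: xi))) a)) =
    fun s => \sum_(i < \dim {:X}) coef rho b`_i a (x0 + s *: xi) *: rVofd (dual_basis i).
  apply/funext => s; rewrite adjoint_sum.
  exact: (linear_combination _ _ rVofd_linear).
apply: is_derive1_sum => i.
have d := coef_diff rho_rep b`_i a.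
have d' : derivable (coef rho b`_i a) (x0 + 0 *: xi) xi.
  by rewrite scale0r addr0; exact: diff_derivable.
have d1 := is_derive1_dir d'.
have d2 := is_derive1_scale d1 (is_derive_cst (rVofd (dual_basis i)) (0 : R) (1 : R)).
by move: d2; rewrite scaler0 addr0 scale0r addr0 deriveE.
Qed.

(** Both sides are derivatives of the same function of [s], because of
    [Vext_transport]: moving the group argument along [xi] amounts to moving
    the parameter along [rho]. *)
Lemma potential_dirD (a : dual X) (xi : 'rV[R]_n) :
  'd VF (x0, rVofd a) (xi, 0) = dirD (Vext 1%g) a (adjoint (drho rho xi) a).
Proof.
rewrite (dirDE Vext_smooth).
have sm := local_fun2_smooth Vext_smooth.
have dV := smooth_on_diff sm (@local_dom2_unit _ _ G _ (rVofd a)).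
have d0 : derivable (@id 'rV[R]_n) (x0 + 0 *: xi) xi by exact: derivable_id.
have dc := is_derive1_dir d0; rewrite derive_id in dc.
have E0 : x0 + 0 *: xi = x0 by rewrite scale0r addr0.
have d1 := is_derive1_pair dc (is_derive_cst (rVofd a) (0 : R) (1 : R)).
have d2 := is_derive1_pair (is_derive_cst x0 (0 : R) (1 : R)) (is_derive_adjoint a xi).
have A0 : adjoint (rho (cinv phi (x0 + 0 *: xi))) a = a.
  by rewrite E0 cinv_x0 (rho1 rho_rep); apply/lfunP => x; rewrite adjointE id_lfunE.
have dV1 : differentiable VF (x0 + 0 *: xi, rVofd a) by rewrite E0.
have dV2 : differentiable VF (x0, rVofd (adjoint (rho (cinv phi (x0 + 0 *: xi))) a)).
  by rewrite A0.
have D1 := is_derive1_comp d1 dV1.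
have D2 := is_derive1_comp d2 dV2.
have nE : \forall s \near (0 : R),
    VF (x0 + s *: xi, rVofd a) =
    VF (x0, rVofd (adjoint (rho (cinv phi (x0 + s *: xi))) a)).
  have cs := is_derive1_continuous dc.
  have o : nbhs (x0 + 0 *: xi) (ccod phi).
    by rewrite E0; exact: near_cod (unit_cod G).
  have n1 : \forall s \near (0 : R), ccod phi (x0 + s *: xi) by exact: cs _ o.
  apply: filterS n1 => s cs1.
  by rewrite /local_fun2 /= !rVofvK cinv_x0 Vext_transport.
have D3 := near_eq_is_derive nE D1.
have K : 'd VF (x0 + 0 *: xi, rVofd a) (xi, 0) =
    'd VF (x0, rVofd (adjoint (rho (cinv phi (x0 + 0 *: xi))) a))
      (0, rVofd (adjoint (drho rho xi) a)) := is_derive1_unique D3 D2.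
by rewrite A0 E0 in K.
Qed.

(** Expanding in the basis of [X] and its dual turns the derivative along
    [drho xi] of the parameter into the pairing with the gradient that defines
    the momentum map. *)
Lemma potential_derivative (a : dual X) (xi : 'rV[R]_n) :
  'd VF (x0, rVofd a) (xi, 0) = momentum rho (grad_dual (Vext 1%g) a) a xi.
Proof.
rewrite potential_dirD momentumE// adjoint_sum.
rewrite (linear_combination (W := R^o) _ _ (dirD_linear Vext_smooth a)).
rewrite /grad_dual !linear_sum; apply: eq_bigr => i _.
by rewrite !linearZ /=; exact: mulrC.
Qed.

End Potential.

(** * The derivative of the cost *)

Section Control.
Variables (R : realType) (n m : nat) (G : lieGroupType R n).
Variables (b : n.-tuple 'rV[R]_n) (e0 : 'rV[R]_n).
Local Notation kT := (subvs_of (kspace m b)).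
Variable C : G -> kT -> R.
Hypothesis C_smooth : smooth_fun2 C.
Local Notation phi := (chart_at (1%g : G)).
Local Notation x0 := (chart_at (1%g : G) 1%g).
Local Notation rVofk := (passmx.rVof (vbasis {:kT})).
Local Notation CF := (local_fun2 C).

Lemma kpart_linear : linear (kpart m b).
Proof. by move=> c u v; rewrite /kpart !linearP. Qed.

Definition kcoord (v : 'rV[R]_n) : 'rV[R]_(\dim {:kT}) := rVofk (kpart m b v).

Lemma kcoord_linear : linear kcoord.
Proof. by move=> c u v; rewrite /kcoord kpart_linear passmx.rVof_linear. Qed.

Definition kcoordL : {linear 'rV[R]_n -> 'rV[R]_(\dim {:kT})} :=
  HB.pack kcoord (GRing.isLinear.Build _ _ _ _ _ kcoord_linear).

Lemma kcoordL_continuous : continuous kcoordL.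
Proof. exact: linear_rV_continuous. Qed.

Lemma dCdu_dirD (u v : 'rV[R]_n) :
  dCdu e0 C u v = dirD (C 1%g) (kpart m b (u - e0)) (kpart m b v).
Proof.
apply: linfunE_of_linear => c v1 v2; rewrite kpart_linear.
exact: (dirD_linear C_smooth).
Qed.

Lemma dCduE (u v : 'rV[R]_n) :
  dCdu e0 C u v = 'd CF (x0, kcoordL (u - e0)) (0, kcoordL v).
Proof. by rewrite dCdu_dirD (dirDE C_smooth). Qed.

Lemma cost_local (u : 'rV[R]_n) :
  C 1%g (kpart m b (u - e0)) = CF (x0, kcoordL (u - e0)).
Proof. by rewrite -(local_fun2E _ _ (mem_chart_at (1%g : G))). Qed.

Lemma dparam_cost (U U' : R -> R -> 'rV[R]_n) (e t : R) :
  dparam U U' e t ->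
  dparam (fun e t => CF (x0, kcoordL (U e t - e0)))
         (fun e t => dCdu e0 C (U e t) (U' e t) : R^o) e t.
Proof.
move=> dU.
have hc := prod_has_coords (rV_has_coords R n) (rV_has_coords R (\dim {:kT})).
have dUc : dparam (fun e t => U e t - e0) U' e t.
  apply: dparam_near (dparam_add dU (dparam_cst (- e0) e t)); first exact: filterE.
  by apply: filterE => z; rewrite addr0.
have dL := dparam_lin kcoordL_continuous dUc.
have dP := dparam_pair (dparam_cst x0 e t) dL.
have dC := dparam_comp hc (@local_dom2_open _ _ G kT) (local_fun2_smooth C_smooth)
  (@local_dom2_unit _ _ G kT _) dP.
apply: dparam_near dC; first exact: filterE.
by apply: filterE => z; rewrite dCduE.
Qed.

Lemma dCdu_continuous (u v : R -> 'rV[R]_n) (t : R) :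
  {for t, continuous u} -> {for t, continuous v} ->
  {for t, continuous (fun s => dCdu e0 C (u s) (v s) : R^o)}.
Proof.
move=> cu cv.
have hc := prod_has_coords (rV_has_coords R n) (rV_has_coords R (\dim {:kT})).
have cst_c (c : 'rV[R]_n) : {for t, continuous (fun _ : R => c)} by exact: cst_continuous.
have cue : {for t, continuous (fun s => u s - e0)}.
  by apply: cvgB; [exact: cu|exact: cst_c].
have c1 : {for t, continuous (fun s => kcoordL (u s - e0))}.
  exact (continuous_comp cue (@kcoordL_continuous _)).
have c2 : {for t, continuous (fun s => kcoordL (v s))}.
  exact (continuous_comp cv (@kcoordL_continuous _)).
have H := continuous_diff_along hc (@local_dom2_open _ _ G kT)
  (local_fun2_smooth C_smooth) (@local_dom2_unit _ _ G kT _)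
  (continuous_pair (cst_c x0) c1) (continuous_pair (cst_c 0) c2).
apply: near_eq_continuous H; apply: filterE => s; by rewrite dCduE.
Qed.

End Control.

Section Pairing.
Variables (R : realType) (n : nat).
Variable ell : R -> dual 'rV[R]_n.

Lemma dual_rV_sum (a : dual 'rV[R]_n) v :
  a v = \sum_i v 0 i *: (a (delta_mx 0 i) : R^o).
Proof.
by rewrite {1}(rV_sum_coords v) linear_sum; apply: eq_bigr => i _; rewrite linearZ.
Qed.

Lemma pairing_continuous (v : R -> 'rV[R]_n) (t : R) :
  (forall w, {for t, continuous (fun s => ell s w : R^o)}) ->
  {for t, continuous v} -> {for t, continuous (fun s => ell s (v s) : R^o)}.
Proof.
move=> cl cv.
have H : {for t, continuous (fun s => \sum_i v s 0 i *: (ell s (delta_mx 0 i) : R^o))}.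
  apply: sum_continuous => i; apply: cvgZ; last exact: cl.
  exact (continuous_comp cv (@coord_continuous R 1 n 0 i (v t))).
by apply: near_eq_continuous H; apply: filterE => s; rewrite -dual_rV_sum.
Qed.

(** The functionals vary with time without being differentiated, and they
    carry no topology of their own, so continuity is required after evaluation
    at each vector. *)
Lemma dparam_pairing (E E' : R -> R -> 'rV[R]_n) (e t : R) :
  (forall w, {for t, continuous (fun s => ell s w : R^o)}) ->
  dparam E E' e t ->
  dparam (fun e t => ell t (E e t) : R^o) (fun e t => ell t (E' e t) : R^o) e t.
Proof.
move=> cl dE; have [N [b [c [cc cb]]]] := rV_has_coords R n.
have lE s v : ell s v = \sum_i c i v *: (ell s (b i) : R^o).
  by rewrite {1}(cb v) linear_sum; apply: eq_bigr => i _; rewrite linearZ.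
have dc i := dparam_lin (cc i) dE.
have ds i := dparam_scale (dc i) (dparam_of_continuous e (cl (b i))).
apply: dparam_near (dparam_sum ds); first by apply: filterE => z; rewrite [RHS]lE.
apply: filterE => z; rewrite [RHS]lE; apply: eq_bigr => i _.
by rewrite scaler0 addr0.
Qed.

End Pairing.

(** * The Euler-Poincare equations *)

Section EulerPoincare.
Variables (R : realType) (n m : nat) (G : lieGroupType R n).
Variables (b : n.-tuple 'rV[R]_n) (e0 : 'rV[R]_n).
Variable C : G -> subvs_of (kspace m b) -> R.
Hypothesis C_smooth : smooth_fun2 C.
Hypothesis C_inv : forall (g h : G) v, C (g * h)%g v = C h v.
Variables (X : vectType R) (alpha0 : dual X) (Vext : G -> dual X -> R).
Hypothesis Vext_smooth : smooth_fun2 Vext.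
Variable rho : G -> 'End(X).
Hypothesis rho_rep : smooth_representation rho.
Hypothesis Vext_inv : forall (g h : G) (a : dual X),
  Vext (g * h)%g (adjoint (rho g^-1%g) a) = Vext h a.
Variables (T : R) (T_gt0 : 0 < T) (g0 gT : G) (g : R -> G) (u : R -> 'rV[R]_n).
Variable lambda : R -> dual 'rV[R]_n.
Hypothesis extremal : normal_extremal e0 C Vext alpha0 T g0 gT g u lambda.
Local Notation I := (`[0, T]%classic : set R).
Local Notation phi := (chart_at (1%g : G)).
Local Notation x0 := (chart_at (1%g : G) 1%g).
Local Notation rVofd := (passmx.rVof (vbasis {:dual X})).

Let g_C1 : C1_curve T g := ext_C1 extremal.
Let uc (t : R) : 'rV[R]_n := left_velocity T g (clamp T t).
Let lc (t : R) : dual 'rV[R]_n := lambda (clamp T t).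
Let ac (t : R) : dual X := adjoint (rho (g (clamp T t))) alpha0.
Let muc (t : R) : dual 'rV[R]_n := dCdu e0 C (uc t) + lc t.
Let Jc (t : R) : dual 'rV[R]_n := momentum rho (grad_dual (Vext 1%g) (ac t)) (ac t).

Lemma uc_continuous : continuous uc.
Proof. exact: left_velocity_continuous. Qed.

Lemma lc_continuous w : continuous (fun t => lc t w : R^o).
Proof.
move=> t; apply: (clamp_continuous_at T_gt0 (f := fun s => lambda s w : R^o)).
have It := clamp_in t T_gt0.
have [H _] := ext_multiplier_C1 extremal w.
exact: is_derive_in_continuous It (derivable_inP (H _ It)).
Qed.

Lemma ac_continuous : continuous (fun t => rVofd (ac t)).
Proof.
move=> t.
have E s : rVofd (ac s) =
    \sum_(i < \dim {:X})
      (alpha0 (rho (g (clamp T s)) (vbasis {:X})`_i) : R) *: rVofd (dual_basis i).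
  rewrite {1}/ac adjoint_sum; exact: (linear_combination _ _ (@rVofd_linear _ X)).
have H : {for t, continuous (fun s => \sum_(i < \dim {:X})
    (alpha0 (rho (g (clamp T s)) (vbasis {:X})`_i) : R) *: rVofd (dual_basis i))}.
  apply: sum_continuous => i; apply: cvgZ; last exact: cvg_cst.
  have c1 : {for t, continuous (fun s => g (clamp T s))}.
    exact: (curve_clamp_continuous T_gt0 g_C1).
  have c2 : {for g (clamp T t),
      continuous (fun h : G => alpha0 (rho h (vbasis {:X})`_i) : R^o)}.
    exact: (matrix_coef_continuous rho_rep).
  exact (continuous_comp c1 c2).
by apply: near_eq_continuous H; apply: filterE => s; rewrite -E.
Qed.

(** In this form the momentum term is visibly continuous in time and linear in
    the direction. *)
Lemma Jc_local (t : R) (v : 'rV[R]_n) :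
  Jc t v = 'd (local_fun2 Vext) (x0, rVofd (ac t)) (v, 0).
Proof. by rewrite (potential_derivative rho_rep Vext_smooth Vext_inv). Qed.

Lemma Jc_continuous v : continuous (fun t => Jc t v : R^o).
Proof.
move=> t.
have hc := prod_has_coords (rV_has_coords R n) (rV_has_coords R (\dim {:dual X})).
have c0 (k : nat) (w : 'rV[R]_k) : {for t, continuous (fun _ : R => w)}.
  exact: cst_continuous.
have H := continuous_diff_along hc (@local_dom2_open _ _ G (dual X))
  (local_fun2_smooth Vext_smooth) (@local_dom2_unit _ _ G (dual X) _)
  (continuous_pair (c0 _ x0) (@ac_continuous t)) (continuous_pair (c0 _ v) (c0 _ 0)).
by apply: near_eq_continuous H; apply: filterE => s; rewrite Jc_local.
Qed.

Lemma muc_continuous (v : R -> 'rV[R]_n) : continuous v ->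
  continuous (fun t => muc t (v t) : R^o).
Proof.
move=> cv t.
have c1 := dCdu_continuous (e0 := e0) C_smooth (@uc_continuous t) (cv t).
have c2 := pairing_continuous (fun w => @lc_continuous w t) (cv t).
have H : {for t, continuous (fun s =>
    (dCdu e0 C (uc s) (v s) : R^o) + (lc s (v s) : R^o))}.
  exact: cvgD c1 c2.
by apply: near_eq_continuous H; apply: filterE => s; rewrite /muc add_lfunE.
Qed.

(** By antisymmetry the bracket is linear in its first argument too, hence
    continuous in the control. *)
Lemma lie_bracket_continuous (eta : 'rV[R]_n) :
  continuous (fun t => lie_bracket G (uc t) eta).
Proof.
pose B (v : 'rV[R]_n) := lie_bracket G v eta.
have lB : linear B.
  have anti v w : lie_bracket G v w = - lie_bracket G w v.
    by rewrite !lie_bracketE opprB.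
  move=> c v w; rewrite /B anti (lie_bracket_linear G) opprD -scalerN -!anti.
  by [].
pose L : {linear 'rV[R]_n -> 'rV[R]_n} := HB.pack B (GRing.isLinear.Build _ _ _ _ _ lB).
move=> t.
exact (continuous_comp (@uc_continuous t) (linear_rV_continuous (L := L) (x := uc t))).
Qed.

(** The action along the variation is the integral of a parametrised function,
    whose derivative at [e = 0] is the integrand below by
    [var_control_derive0] and [potential_derivative]. *)
Lemma stationary_weak (eta : 'rV[R]_n) (f f' : R -> R) : continuous f' ->
  (forall t : R, t \in `[0, T] -> is_derive t (1 : R) (f : R -> R^o) (f' t)) ->
  f 0 = 0 -> f T = 0 ->
  Rintegral lebesgue_measure `[0, T]
    (fun t => f' t * muc t eta +
              f t * (muc t (lie_bracket G (uc t) eta) + Jc t eta)) = 0.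
Proof.
move=> cf' df f0 fT.
have [d d0 drange] := exists_var_range G T_gt0 eta df.
have is_var := variation_is_variation T_gt0 g_C1 cf' df d0 drange f0 fT.
have stat := ext_stationary extremal is_var.
have [U' dU] := dparam_var_control_ex T_gt0 g_C1 cf' df drange.
pose U := var_control T g f f' eta.
pose F (e t : R) : R^o :=
  local_fun2 C (x0, kcoordL m b (U e t - e0)) +
  local_fun2 Vext (var_point G T f eta e t, rVofd (ac t)) +
  (lc t (U e t - e0) : R^o).
have hc := prod_has_coords (rV_has_coords R n) (rV_has_coords R (\dim {:dual X})).
pose F' (e t : R) : R^o :=
  (dCdu e0 C (U e t) (U' e t) : R^o) +
  'd (local_fun2 Vext) (var_point G T f eta e t, rVofd (ac t)) (f (clamp T t) *: eta, 0) +
  (lc t (U' e t) : R^o).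
have dF e t : `|e| < d -> dparam F F' e t.
  move=> ed; have dUe := dU e t ed.
  have dUc : dparam (fun e t => U e t - e0) U' e t.
    apply: dparam_near (dparam_add dUe (dparam_cst (- e0) e t)); first exact: filterE.
    by apply: filterE => z; rewrite addr0.
  have dC := dparam_cost e0 C_smooth dUe.
  have dl := dparam_pairing (fun w => @lc_continuous w t) dUc.
  have dz := dparam_var_point G T_gt0 eta df e t.
  have dP := dparam_pair dz (dparam_of_continuous e (@ac_continuous t)).
  have cr : local_dom2 G (W := dual X) (var_point G T f eta e t, rVofd (ac t)).
    by have [] := drange e t ed.
  have dV := dparam_comp hc (@local_dom2_open _ _ G (dual X))
    (local_fun2_smooth Vext_smooth) cr dP.
  exact: dparam_add (dparam_add dC dV) dl.
have dI := is_derive_Rintegral T d0 dF.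
(* invariance of the cost and of the potential remove the curve [g] *)
have nE : \forall e \near (0 : R),
    (Rintegral lebesgue_measure `[0, T] (F e) : R^o) =
    action e0 C Vext alpha0 T lambda (variation T g f eta e).
  have zs : `|0 : R| < d by rewrite normr0.
  have := near_slice (near_small 0 zs); apply: filterS => e /= ed.
  apply: eq_Rintegral => t; rewrite inE => It.
  rewrite /lagrangian (left_velocity_variation T_gt0 g_C1 df drange It ed).
  rewrite -/U /F; congr (_ + _ + _).
  - rewrite -cost_local -[variation T g f eta e t]mulg1.
    by rewrite C_inv.
  - rewrite /local_fun2 /= rVofvK /variation /var_factor.
    rewrite -[in LHS](Vext_inv (g (clamp T t))) /ac; congr (Vext _ _).
    apply/lfunP => x; rewrite !adjointE -(rhoM rho_rep) mulgV (rho1 rho_rep).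
    by rewrite id_lfunE.
  - by rewrite /lc clampE.
have dI' := near_eq_is_derive nE dI.
have I0 := is_derive1_unique dI' stat.
rewrite -[RHS]I0; apply: eq_Rintegral => t; rewrite inE => It.
have zs : `|0 : R| < d by rewrite normr0.
have EU' := var_control_derive0 T_gt0 g_C1 cf' df d0 drange (dU 0 t zs).
have EU0 := var_control0 g f' d0 drange t.
have ct : clamp T t = t by exact: clampE.
have EJ : 'd (local_fun2 Vext) (var_point G T f eta 0 t, rVofd (ac t))
    (f (clamp T t) *: eta, 0) = f t * Jc t eta.
  by rewrite var_point0 -Jc_local ct linearZ.
rewrite /F' EJ EU' /U EU0 -/(uc t) ct.
have Em (w : 'rV[R]_n) : muc t w = dCdu e0 C (uc t) w + lc t w by rewrite /muc add_lfunE.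
rewrite !Em; move: (lie_bracket G (uc t) eta) => br.
rewrite !linearD !linearZ /=.
have reassoc (p q r1 r2 r3 r4 r5 : R) :
  p * (r1 + r3) + q * (r2 + r4 + r5) = p * r1 + q * r2 + q * r5 + (p * r3 + q * r4).
  ring.
exact: reassoc.
Qed.

(** [du_bois_reymond] applied to [stationary_weak] in a fixed direction [eta];
    the pairing with the bracket is the coadjoint term. *)
Lemma momentum_equation (t : R) : t \in `[0, T] ->
  dual_is_derive_in I (fun s => dCdu e0 C (u s) + lambda s) t
    (coad G (u t) (dCdu e0 C (u t) + lambda t)
     + momentum rho (grad_dual (Vext 1%g) (adjoint (rho (g t)) alpha0))
         (adjoint (rho (g t)) alpha0)).
Proof.
move=> It eta.
have ca : continuous (fun s => muc s eta : R^o).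
  by apply: muc_continuous; exact: cst_continuous.
have cb : continuous (fun s => muc s (lie_bracket G (uc s) eta) + Jc s eta : R^o).
  move=> s; exact (cvgD (muc_continuous (@lie_bracket_continuous eta) (x := s))
    (@Jc_continuous eta s)).
have H := du_bois_reymond T_gt0 ca cb (@stationary_weak eta) It.
have muE s : I s -> muc s = dCdu e0 C (u s) + lambda s.
  move=> Is; have cs : clamp T s = s := clampE Is.
  have us : u s = left_velocity T g s := ext_control extremal Is.
  by rewrite /muc /uc /lc cs us.
have D : muc t (lie_bracket G (uc t) eta) + Jc t eta =
    (coad G (u t) (dCdu e0 C (u t) + lambda t)
     + momentum rho (grad_dual (Vext 1%g) (adjoint (rho (g t)) alpha0))
         (adjoint (rho (g t)) alpha0)) eta.
  have ct : clamp T t = t := clampE It.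
  have ut : u t = left_velocity T g t := ext_control extremal It.
  rewrite [RHS]add_lfunE /coad adjointE adE -(muE t It) ut.
  by rewrite /Jc /ac /uc ct.
rewrite -D; apply: (is_derive_in_eq It) H => s Is.
by rewrite muE.
Qed.

End EulerPoincare.

Unset Implicit Arguments.

Theorem theorem1 (R : realType) (n m : nat) (G : lieGroupType R n)
  (hm : (1 <= m <= n)%N)
  (b : n.-tuple 'rV[R]_n) (hb : basis_of {:'rV[R]_n} b)
  (e0 : 'rV[R]_n) (he0 : e0 \in pspace m b)
  (C : G -> subvs_of (kspace m b) -> R)
  (C_smooth : smooth_fun2 C)
  (C_inv : forall (g h : G) v, C (g * h)%g v = C h v)
  (V : G -> R)
  (V_smooth : smooth_fun V)
  (V_not_inv : ~ (forall g h : G, V (g * h)%g = V h))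
  (X : vectType R) (alpha0 : dual X)
  (Vext : G -> dual X -> R)
  (Vext_smooth : smooth_fun2 Vext)
  (Vext_alpha0 : forall g : G, Vext g alpha0 = V g)
  (rho : G -> 'End(X))
  (rho_rep : smooth_representation rho)
  (Vext_inv : forall (g h : G) (a : dual X),
     Vext (g * h)%g (adjoint (rho g^-1%g) a) = Vext h a)
  (V_isotropy : forall g h : G,
     adjoint (rho g) alpha0 = alpha0 -> V (g * h)%g = V h)
  (T : R) (hT : 0 < T) (g0 gT : G)
  (g : R -> G) (u : R -> 'rV[R]_n) (lambda : R -> dual 'rV[R]_n)
  (hext : normal_extremal e0 C Vext alpha0 T g0 gT g u lambda) :
  let alpha := fun t => adjoint (rho (g t)) alpha0 in
  let mu := fun t => dCdu e0 C (u t) + lambda t in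
  (forall t, t \in `[0, T] ->
     dual_is_derive_in `[0, T] mu t
       (coad G (u t) (mu t)
        + momentum rho (grad_dual (Vext 1%g) (alpha t)) (alpha t))) /\
  (forall t, t \in `[0, T] ->
     dual_is_derive_in `[0, T] alpha t (adjoint (drho rho (u t)) (alpha t))) /\
  alpha 0 = adjoint (rho g0) alpha0.
Proof.
move=> alpha mu; split; [|split].
- move=> t It.
  exact: (momentum_equation C_smooth C_inv Vext_smooth rho_rep Vext_inv hT hext It).
- move=> t It; rewrite (ext_control hext It).
  exact: (@advected_is_derive _ _ _ _ _ rho_rep _ _ alpha0 (ext_C1 hext) t It).
- by rewrite /alpha (ext_init hext).
Qed.
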